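(* Let $\mathcal{G}$ be a Riemannian metric on the $2$-torus $\mathbb{T}^2$, let $\mathcal{G}_0$ be the unit area flat metric in the conformal class of $\mathcal{G}$, and let $f>0$ be the conformal factor, so that $\mathcal{G} = f^2\mathcal{G}_0$. Then $$\operatorname{area}(\mathcal{G}) - \tfrac{\sqrt{3}}{2}\, \operatorname{sys}(\mathcal{G})^2 \;\geq\; \operatorname{Var}(f).$$
   Context: The systole $\operatorname{sys}(\mathcal{G})$ is the least $\mathcal{G}$-length of a noncontractible loop on $\mathbb{T}^2$; $\operatorname{area}(\mathcal{G})$ is the total area. By the uniformisation theorem, for every metric $\mathcal{G}$ on $\mathbb{T}^2$ there are a lattice $L\subset\mathbb{R}^2$, which may be normalised to have coarea $1$, and a positive $L$-periodic function $f(x,y)$ on $\mathbb{R}^2$ such that $(\mathbb{T}^2,\mathcal{G})$ is isometric to $(\mathbb{R}^2/L,\ f^2(dx^2+dy^2))$. The metric $\mathcal{G}_0=dx^2+dy^2$ on $\mathbb{R}^2/L$ is the unit area flat metric in the conformal class of $\mathcal{G}$, and $f$ is the conformal factor. The variance is taken with respect to the probability measure $\mu$ on $\mathbb{T}^2$ given by the area measure of $\mathcal{G}_0$: $\operatorname{Var}(f)=\int_{\mathbb{T}^2}(f-m)^2\,d\mu$, where $m=\int_{\mathbb{T}^2} f\,d\mu$. *)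

(* Defs.v *)
From HB Require Import structures.
From mathcomp Require Import all_boot all_order all_algebra.
From mathcomp Require Import all_classical all_reals all_analysis.

Set Implicit Arguments.
Unset Strict Implicit.
Unset Printing Implicit Defensive.

Import Order.TTheory GRing.Theory Num.Theory.
Import numFieldNormedType.Exports.

Local Open Scope classical_set_scope.
Local Open Scope ring_scope.

(* The 2-torus is R^2 / Z^2. Its points, functions, tensors, loops and
   homotopies are represented by their lifts to the universal cover R^2, which
   is the type R * R. *)

Section Smooth.
Context {R : realType} {V W : normedModType R}.

(* Class C^n, for V of finite dimension. *)
Fixpoint Ck (n : nat) (f : V -> W) : Prop :=
  if n is n'.+1 then
    (forall p, differentiable f p) /\ (forall v, Ck n' (fun p => 'D_v f p))
  else continuous f.

Definition smooth (f : V -> W) : Prop := forall n, Ck n f.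

End Smooth.

Section Torus.
Context {R : realType}.
Implicit Types (p q u v w : R * R) (f h : R * R -> R).

Definition dot u v : R := u.1 * v.1 + u.2 * v.2.

(* a and b form a basis of R^2 *)
Definition lattice_basis (a b : R * R) : Prop := a.1 * b.2 - a.2 * b.1 != 0.

Definition lattice (a b : R * R) : set (R * R) :=
  [set p | exists m n : int, p = m%:~R *: a + n%:~R *: b].

Definition Z2 : set (R * R) := lattice (1, 0) (0, 1).

Definition torus_fun {T : Type} (F : R * R -> T) : Prop :=
  forall p z, Z2 z -> F (p + z) = F p.

(* Tangent spaces are identified with R * R by the standard coordinates. *)
Record torus_metric := TorusMetric {
  metric_form :> R * R -> R * R -> R * R -> R;
  metric_smooth : forall u v, smooth (fun p => metric_form p u v);
  metric_periodic : torus_fun metric_form;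
  metric_linear : forall p (c : R) u v w,
    metric_form p (c *: u + v) w = c * metric_form p u w + metric_form p v w;
  metric_sym : forall p u v, metric_form p u v = metric_form p v u;
  metric_pos : forall p u, u != 0 -> 0 < metric_form p u u
}.
Implicit Types G : torus_metric.

(* The area element sqrt (EG - F^2). *)
Definition area_density G p : R :=
  Num.sqrt (G p (1, 0) (1, 0) * G p (0, 1) (0, 1) - G p (1, 0) (0, 1) ^+ 2).

(* Integral of h over the torus for the area measure of G, computed on the
   fundamental domain [0, 1]^2. *)
Definition torus_integral G h : R :=
  \int[(lebesgue_measure \x lebesgue_measure)%E]_(p in `[0, 1] `*` `[0, 1])
    (h p * area_density G p).

Definition area G : R := torus_integral G (fun=> 1).

Definition torus_mean G h : R := torus_integral G h.

(* The variance for the area measure of G, which is meant to be a probability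
   measure: area G = 1. *)
Definition torus_variance G h : R :=
  torus_integral G (fun p => (h p - torus_mean G h) ^+ 2).

(* c is C^1 on every closed piece of a subdivision of [0, 1]; only the
   restriction of c to [0, 1] matters. *)
Definition piecewise_C1 (c : R -> R * R) : Prop :=
  exists s : seq R,
    [/\ path <%R 0 s, last 0 s = 1 &
        forall i, (i < size s)%N -> exists d : R -> R * R,
          Ck 1 d /\
          forall t, nth 0 (0 :: s) i <= t <= nth 0 s i -> c t = d t].

Definition torus_loop (c : R -> R * R) : Prop :=
  piecewise_C1 c /\ Z2 (c 1 - c 0).

(* Free homotopy through loops of the torus to a constant loop of the torus,
   (s, t) |-> H (s, t) being a lift of the homotopy. *)
Definition contractible_loop (c : R -> R * R) : Prop :=
  exists H : R * R -> R * R,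
    [/\ {within `[0, 1] `*` `[0, 1], continuous H},
        forall t, 0 <= t <= 1 -> H (0, t) = c t,
        forall s, 0 <= s <= 1 -> Z2 (H (s, 1) - H (s, 0)) &
        forall t, 0 <= t <= 1 -> Z2 (H (1, t) - H (1, 0))].

(* The velocity may be undefined at the finitely many break points, which are
   negligible. *)
Definition loop_length G (c : R -> R * R) : R :=
  \int[lebesgue_measure]_(t in `[0, 1])
    Num.sqrt (G (c t) ('D_1 c t) ('D_1 c t)).

Definition systole G : R :=
  inf [set l | exists c, [/\ torus_loop c, ~ contractible_loop c
                           & l = loop_length G c]].

(* G is isometric to the quotient of the Euclidean plane by some lattice L:
   phi is the lift of a diffeomorphism R^2 / Z^2 -> R^2 / L that pulls the
   metric dx^2 + dy^2 back to G. *)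
Definition flat G : Prop :=
  exists (a b : R * R) (phi psi : R * R -> R * R),
    [/\ lattice_basis a b,
        smooth phi /\ smooth psi,
        cancel phi psi /\ cancel psi phi,
        forall p q, Z2 (p - q) <-> lattice a b (phi p - phi q) &
        forall p u v, G p u v = dot ('D_u phi p) ('D_v phi p)].

(* f is the conformal factor: G = f^2 G0 with f > 0. *)
Definition conformal_factor G G0 f : Prop :=
  [/\ smooth f, torus_fun f, forall p, 0 < f p &
      forall p u v, G p u v = f p ^+ 2 * G0 p u v].

End Torus.

Arguments torus_metric R : clear implicits.

(* Main.v *)
From HB Require Import structures.
From mathcomp Require Import all_boot all_order all_algebra.
From mathcomp Require Import all_classical all_reals all_analysis.
From mathcomp Require Import measurable_realfun ring lra zify.
Require Import Defs.

(* Write the flat metric as the pull-back of the Euclidean metric by phi, with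
   inverse psi, and let A, B be the deck translations phi (p + e_i) - phi p.  As
   the Jacobian determinant is a null Lagrangian, its integral over the unit
   square is det (A, B); so the area of G0 is |det (A, B)| = 1, and Hermite's
   inequality gives a vector w of the lattice spanned by A and B with
   0 < |w|^2 <= 2 / sqrt 3.

   The closed geodesics t |-> psi (phi p + t w) have G-length |w| times the mean
   of f along them.  The translation flow of w preserves the area of G0, so the
   mean of these means over p is the mean m of f; hence sys G <= |w| m, that is
   sqrt 3 / 2 * sys G ^ 2 <= m ^ 2.  Finally Var f = area G - m ^ 2. *)

Set Implicit Arguments.
Unset Strict Implicit.
Unset Printing Implicit Defensive.
Import Order.TTheory GRing.Theory Num.Theory.
Import numFieldNormedType.Exports.
Local Open Scope classical_set_scope.
Local Open Scope ring_scope.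

(** * Integration over the unit square *)

(** The averaging step hides a change of variables: the flow p |-> psi (phi p + t w) moves the unit
    square away from itself, so its invariance is not read off a transformation formula. It is
    proved infinitesimally. For g with periods A and B, the derivative of g along w, times the
    Jacobian of phi, is again a Jacobian whose first component is periodic; Fubini and the
    fundamental theorem of calculus on the fixed square make its integral vanish. A shift by d w
    therefore raises the mean by O(d^2) at most, and a Riemann sum with N terms in place of the time
    integral gives the required inequality up to O(1/N).

    Discreteness of the lattices is used through one principle: a continuous path with values in a
    lattice is constant. It makes phi (p + e_i) - phi p independent of p, and it makes the
    displacement of a lifted loop invariant under homotopy. The factor sqrt 3 / 2 is the reciprocal
    of Hermite's constant 2 / sqrt 3 in dimension two, so it cancels the bound on |w|^2 exactly. *)

Lemma pair_continuous_at (T U V : topologicalType) (f : T -> U) (g : T -> V) x :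
  {for x, continuous f} -> {for x, continuous g} ->
  {for x, continuous (fun y => (f y, g y))}.
Proof. by move=> cf cg; exact: (cvg_pair cf cg). Qed.

Section Square.
Context {R : realType}.
Implicit Types h : R * R -> R.
Notation mu := (@lebesgue_measure R).
Notation mu2 := ((mu \x mu)%E).
Notation I01 := (`[0%R, 1%R]%classic : set R).

(** Rectangles generate the product sigma-algebra, so U is exhausted by countably many of them: the
    boxes with rational centre and radius [1 / (n + 1)] that lie in U. The other indices contribute
    the empty set. *)
Lemma open_measurable_prod (U : set (R * R)) : open U -> measurable U.
Proof.
move=> oU.
pose box (i : rat * rat * nat) : set (R * R) :=
  ball (ratr i.1.1 : R) (i.2.+1%:R^-1) `*` ball (ratr i.1.2 : R) (i.2.+1%:R^-1).
pose F i := if `[< box i `<=` U >] then box i else set0.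
have -> : U = \bigcup_i F i.
  apply/seteqP; split => [p Up|p [i _]]; last first.
    by rewrite /F; case: asboolP => // sub px; exact: sub.
  have /nbhs_ballP[e /= e0 pe] : nbhs p U by exact: open_nbhs_nbhs.
  have [n ne] : exists n : nat, n.+1%:R^-1 < e / 2.
    have e20 : 0 < e / 2 by rewrite divr_gt0.
    by have [n] := ltr_add_invr e20; rewrite add0r => ?; exists n.
  have n0 : 0 < n.+1%:R^-1 :> R by rewrite invr_gt0.
  have dr (x : R) : exists q : rat, ball (ratr q : R) n.+1%:R^-1 x.
    have : ball x n.+1%:R^-1 `&` range (@ratr R) !=set0.
      apply: dense_rat; last exact: ball_open.
      by exists x; exact: ballxx.
    by move=> [y [+ [q _ qy]]]; rewrite -qy => xq; exists q; exact: ball_sym.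
  have [q1 hq1] := dr p.1; have [q2 hq2] := dr p.2.
  exists (q1, q2, n) => //; rewrite /F.
  case: asboolP => [_ //|[]].
  move=> z [/= z1 z2]; apply: pe; rewrite (splitr e).
  by split; [apply: (ball_triangle (ball_sym (le_ball (ltW ne) hq1)))
            |apply: (ball_triangle (ball_sym (le_ball (ltW ne) hq2)))];
     apply: le_ball (ltW ne) _ _.
apply: countable_bigcupT_measurable => // i.
rewrite /F; case: asboolP => // _.
by apply: measurableX; exact: measurable_ball.
Qed.

Lemma continuous_measurable_prod h D : continuous h -> measurable_fun D h.
Proof.
move=> ch; apply: (measurable_funS measurableT) => //.
apply: (measurability _ (RGenOpens.measurableE R)).
move=> _ [_ [a [b ->]] <-]; rewrite setTI.
apply: open_measurable_prod; apply: open_comp => // *; exact: ch.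
Qed.

Lemma measurable_square : measurable (I01 `*` I01).
Proof. by apply: measurableX. Qed.

Lemma square_measure : mu2 (I01 `*` I01) = 1%E.
Proof.
by rewrite product_measure1E//= lebesgue_measure_itv/= lte_fin ltr01 -EFinB subr0 mule1.
Qed.

Lemma compact_square : compact (I01 `*` I01).
Proof. apply: compact_setX; exact: segment_compact. Qed.

Lemma continuous_bounded_square h : continuous h ->
  exists M, forall p, (I01 `*` I01) p -> `|h p| <= M.
Proof.
move=> ch.
have [||c _ hc] := @compact_EVT_max _ R (fun p => `|h p|) _ _ compact_square.
- by exists (0, 0); split => /=; rewrite in_itv/= lexx ler01.
- by apply: continuous_subspaceT => p; apply: cvg_norm; exact: ch.
by exists `|h c| => p Qp; apply: hc; exact: mem_set.
Qed.

Lemma continuous_integrable_square h : continuous h ->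
  mu2.-integrable (I01 `*` I01) (EFin \o h).
Proof.
move=> ch; apply: measurable_bounded_integrable.
- exact: measurable_square.
- by rewrite [ltLHS]square_measure ltry.
- exact: continuous_measurable_prod.
have [M hM] := continuous_bounded_square ch.
exists M; split; first exact: num_real.
by move=> x Mx p Qp; exact: le_trans (hM _ Qp) (ltW Mx).
Qed.

Lemma continuous_pairr h x : continuous h -> continuous (fun y => h (x, y)).
Proof.
move=> ch y; apply: (@continuous_comp _ _ _ (fun y => (x, y)) h); last exact: ch.
by apply: pair_continuous_at; [exact: cst_continuous|].
Qed.

Lemma continuous_pairl h y : continuous h -> continuous (fun x => h (x, y)).
Proof.
move=> ch x; apply: (@continuous_comp _ _ _ (fun x => (x, y)) h); last exact: ch.
by apply: pair_continuous_at; [|exact: cst_continuous].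
Qed.

Lemma continuous_integrable_I01 (h : R -> R) : continuous h ->
  mu.-integrable I01 (EFin \o h).
Proof.
move=> ch; apply: continuous_compact_integrable; first exact: segment_compact.
exact: continuous_subspaceT.
Qed.

(** Fubini is applied on the whole plane to h extended by 0 off the square. The inner integrals are
    finite, so [fine] loses nothing. *)
Lemma Rintegral_square12 h : continuous h ->
  \int[mu2]_(p in I01 `*` I01) h p = \int[mu]_(x in I01) \int[mu]_(y in I01) h (x, y).
Proof.
move=> ch; rewrite /Rintegral integral_mkcond -integral12_prod_meas1; last first.
  refine ((@integrable_mkcond _ _ _ _ _ _ _).1 _).
    exact: measurable_square.
  exact: continuous_integrable_square.
congr fine; rewrite [RHS]integral_mkcond; apply: eq_integral => x _.
rewrite /fubini_F /= patchE; case: ifPn => xI.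
  rewrite fineK; last by apply: integrable_fin_num => //; apply: continuous_integrable_I01;
    exact: continuous_pairr.
  rewrite [RHS]integral_mkcond; apply: eq_integral => y _.
  by rewrite !patchE in_setX xI.
by apply: integral0_eq => y _; rewrite patchE in_setX (negbTE xI).
Qed.

Lemma Rintegral_square21 h : continuous h ->
  \int[mu2]_(p in I01 `*` I01) h p = \int[mu]_(y in I01) \int[mu]_(x in I01) h (x, y).
Proof.
move=> ch; rewrite /Rintegral integral_mkcond -integral21_prod_meas1; last first.
  refine ((@integrable_mkcond _ _ _ _ _ _ _).1 _).
    exact: measurable_square.
  exact: continuous_integrable_square.
congr fine; rewrite [RHS]integral_mkcond; apply: eq_integral => y _.
rewrite /fubini_G /= patchE; case: ifPn => yI.
  rewrite fineK; last by apply: integrable_fin_num => //; apply: continuous_integrable_I01;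
    exact: continuous_pairl.
  rewrite [RHS]integral_mkcond; apply: eq_integral => x _.
  by rewrite !patchE in_setX yI andbT.
by apply: integral0_eq => x _; rewrite patchE in_setX (negbTE yI) andbF.
Qed.

(** The two-sided derivative at 0 and 1 provides the one-sided continuity of F at the ends that the
    fundamental theorem of calculus asks for. *)
Lemma Rintegral_I01_derive (F f : R -> R) : continuous f ->
  (forall t : R, 0 <= t <= 1 -> is_derive t 1 F (f t)) ->
  \int[mu]_(t in I01) f t = F 1 - F 0.
Proof.
move=> cf dF.
have cF t : 0 <= t <= 1 -> {for t, continuous F}.
  by move=> t01; apply/differentiable_continuous/derivable1_diffP; case: (dF t t01).
have oc t : t \in `]0, 1[ -> 0 <= t <= 1 by rewrite in_itv => /andP[/ltW-> /ltW->].
rewrite /Rintegral (@continuous_FTC2 _ f F)//.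
- exact: continuous_subspaceT.
- split; first by move=> x /oc x01; case: (dF x x01).
    by apply: cvg_at_right_filter; apply: cF; rewrite lexx ler01.
  by apply: cvg_at_left_filter; apply: cF; rewrite lexx ler01.
- by move=> x /oc x01; rewrite derive1E; case: (dF x x01).
Qed.

Lemma Rintegral_squareD h1 h2 : continuous h1 -> continuous h2 ->
  \int[mu2]_(p in I01 `*` I01) (h1 p + h2 p) =
  \int[mu2]_(p in I01 `*` I01) h1 p + \int[mu2]_(p in I01 `*` I01) h2 p.
Proof.
move=> c1 c2; apply: RintegralD; first exact: measurable_square.
  exact: continuous_integrable_square.
exact: continuous_integrable_square.
Qed.

Lemma Rintegral_squareZ h (k : R) : continuous h ->
  \int[mu2]_(p in I01 `*` I01) (k * h p) = k * \int[mu2]_(p in I01 `*` I01) h p.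
Proof.
move=> ch; apply: RintegralZl; first exact: measurable_square.
exact: continuous_integrable_square.
Qed.

Lemma le_Rintegral_square h1 h2 : continuous h1 -> continuous h2 ->
  (forall p, h1 p <= h2 p) ->
  \int[mu2]_(p in I01 `*` I01) h1 p <= \int[mu2]_(p in I01 `*` I01) h2 p.
Proof.
move=> c1 c2 h12; apply: le_Rintegral => //; first exact: measurable_square.
  exact: continuous_integrable_square.
exact: continuous_integrable_square.
Qed.
End Square.

(** * Functions of class C^n *)

Section Chain.
Context {R : realType}.

Lemma derive_comp (U V W : normedModType R) (f : V -> W) (c : U -> V) x u :
  differentiable c x -> differentiable f (c x) ->
  'D_u (f \o c) x = 'D_('D_u c x) f (c x).
Proof.
move=> dc df; rewrite !deriveE//; last exact: differentiable_comp.
by rewrite diff_comp.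
Qed.

Lemma differentiable_line (V : normedModType R) (y w : V) (t : R) :
  differentiable (fun s : R => y + s *: w) t.
Proof.
apply: (@differentiableD _ _ _ (cst y)); first exact: differentiable_cst.
apply: (@differentiableZl _ _ _ id); exact: ex_diff.
Qed.

Lemma derive_line (V : normedModType R) (y w : V) (t v : R) :
  'D_v (fun s : R => y + s *: w) t = v *: w.
Proof.
have did : differentiable (id : R -> R) t by exact: ex_diff.
have dz := differentiableZl w did.
rewrite deriveE; last exact: differentiable_line.
rewrite (diffD (differentiable_cst y t) dz) diff_cst /= add0r (diffZl w did).
by rewrite diff_val.
Qed.

Lemma is_derive_line (V W : normedModType R) (f : V -> W) (y w : V) (t : R) :
  differentiable f (y + t *: w) ->
  is_derive t (1 : R) (fun s : R => f (y + s *: w)) ('D_w f (y + t *: w)).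
Proof.
move=> df; have dl := differentiable_line y w t.
apply: DeriveDef; first exact/derivable1_diffP/(differentiable_comp dl).
by rewrite (derive_comp _ dl)// derive_line scale1r.
Qed.

Lemma derive_add (V W : normedModType R) (f : V -> W) x u v :
  differentiable f x -> 'D_(u + v) f x = 'D_u f x + 'D_v f x.
Proof. by move=> df; rewrite !deriveE// linearD. Qed.

Lemma derive_scale (V W : normedModType R) (f : V -> W) x k v :
  differentiable f x -> 'D_(k *: v) f x = k *: 'D_v f x.
Proof. by move=> df; rewrite !deriveE// linearZ. Qed.

Lemma derive_pair (V W W' : normedModType R) (f : V -> W) (g : V -> W') x v :
  differentiable f x -> differentiable g x ->
  'D_v (fun y => (f y, g y)) x = ('D_v f x, 'D_v g x).
Proof.
move=> df dg; rewrite !deriveE//; last exact: differentiable_pair.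
by rewrite diff_pair.
Qed.

Lemma derive_coord (f : R * R -> R) p v : differentiable f p ->
  'D_v f p = v.1 * 'D_(1, 0) f p + v.2 * 'D_(0, 1) f p.
Proof.
move=> df.
rewrite -[RHS]/(v.1 *: 'D_(1, 0) f p + v.2 *: 'D_(0, 1) f p).
rewrite -!derive_scale// -derive_add//; congr ('D__ f p).
case: v => a b /=; congr pair.
  by rewrite -[RHS]/(a * 1 + b * 0) mulr1 mulr0 addr0.
by rewrite -[RHS]/(a * 0 + b * 1) mulr1 mulr0 add0r.
Qed.

Lemma differentiable_fst (V W W' : normedModType R) (f : V -> W * W') x :
  differentiable f x -> differentiable (fun y => (f y).1) x.
Proof.
move=> df; apply: (@differentiable_comp _ _ _ _ f fst) => //.
apply: linear_differentiable => y; exact: cvg_fst.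
Qed.

Lemma differentiable_snd (V W W' : normedModType R) (f : V -> W * W') x :
  differentiable f x -> differentiable (fun y => (f y).2) x.
Proof.
move=> df; apply: (@differentiable_comp _ _ _ _ f snd) => //.
apply: linear_differentiable => y; exact: cvg_snd.
Qed.

Lemma derive_fst (V W W' : normedModType R) (f : V -> W * W') x v :
  differentiable f x -> 'D_v (fun y => (f y).1) x = ('D_v f x).1.
Proof.
move=> df; have d1 := differentiable_fst df; have d2 := differentiable_snd df.
rewrite -[in RHS](_ : (fun y => ((f y).1, (f y).2)) = f) ?derive_pair//.
by apply/funext => y; case: (f y).
Qed.

Lemma derive_snd (V W W' : normedModType R) (f : V -> W * W') x v :
  differentiable f x -> 'D_v (fun y => (f y).2) x = ('D_v f x).2.
Proof.
move=> df; have d1 := differentiable_fst df; have d2 := differentiable_snd df.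
rewrite -[in RHS](_ : (fun y => ((f y).1, (f y).2)) = f) ?derive_pair//.
by apply/funext => y; case: (f y).
Qed.
End Chain.

Section CkTheory.
Context {R : realType}.

Lemma CkS (V W : normedModType R) n (f : V -> W) : Ck n.+1 f -> Ck n f.
Proof.
elim: n f => [|n IHn] f [df dnf]; first by move=> p; exact: differentiable_continuous.
by split=> // v; exact/IHn/dnf.
Qed.

Lemma eq_Ck (V W : normedModType R) n (f g : V -> W) : f =1 g -> Ck n f -> Ck n g.
Proof. by move=> /funext ->. Qed.

Lemma Ck_cst (V W : normedModType R) n (w : W) : Ck n (fun _ : V => w).
Proof.
elim: n w => [|n IHn] w; first exact: cst_continuous.
split=> [p|v]; first exact: differentiable_cst.
by apply: (@eq_Ck _ _ _ (fun=> 0)) => [p|]; [exact/esym/derive_cst|exact: IHn].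
Qed.

Lemma CkD (V W : normedModType R) n (f g : V -> W) : Ck n f -> Ck n g ->
  Ck n (fun p => f p + g p).
Proof.
elim: n f g => [|n IHn] f g; first by move=> cf cg p; apply: cvgD; [exact: cf|exact: cg].
move=> [df dnf] [dg dng]; split=> [p|v]; first exact: differentiableD.
apply: (@eq_Ck _ _ _ (fun p => 'D_v f p + 'D_v g p)) => [p|]; last by apply: IHn; [exact: dnf|exact: dng].
by symmetry; apply: deriveD; exact: diff_derivable.
Qed.

Lemma CkM (V : normedModType R) n (f g : V -> R) : Ck n f -> Ck n g ->
  Ck n (fun p => f p * g p).
Proof.
elim: n f g => [|n IHn] f g; first by move=> cf cg p; apply: cvgM; [exact: cf|exact: cg].
move=> /[dup] /CkS Cf [df dnf] /[dup] /CkS Cg [dg dng].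
split=> [p|v]; first exact: differentiableM.
apply: (@eq_Ck _ _ _ (fun p => f p * 'D_v g p + g p * 'D_v f p)) => [p|].
  by symmetry; apply: deriveM; exact: diff_derivable.
by apply: CkD; apply: IHn => //; [exact: dng|exact: dnf].
Qed.

Lemma Ck_fst (V W W' : normedModType R) n (f : V -> W * W') : Ck n f ->
  Ck n (fun p => (f p).1).
Proof.
elim: n f => [|n IHn] f; first by move=> cf p; apply: (cvg_comp _ _ (cf p)); exact: cvg_fst.
move=> [df dnf]; split=> [p|v]; first exact: differentiable_fst.
apply: (@eq_Ck _ _ _ (fun p => ('D_v f p).1)) => [p|]; last exact/IHn/dnf.
by symmetry; apply: derive_fst.
Qed.

Lemma Ck_snd (V W W' : normedModType R) n (f : V -> W * W') : Ck n f ->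
  Ck n (fun p => (f p).2).
Proof.
elim: n f => [|n IHn] f; first by move=> cf p; apply: (cvg_comp _ _ (cf p)); exact: cvg_snd.
move=> [df dnf]; split=> [p|v]; first exact: differentiable_snd.
apply: (@eq_Ck _ _ _ (fun p => ('D_v f p).2)) => [p|]; last exact/IHn/dnf.
by symmetry; apply: derive_snd.
Qed.

Lemma Ck_pair (V W W' : normedModType R) n (f : V -> W) (g : V -> W') : Ck n f -> Ck n g ->
  Ck n (fun p => (f p, g p)).
Proof.
elim: n f g => [|n IHn] f g; first by move=> cf cg p; apply: cvg_pair; [exact: cf|exact: cg].
move=> [df dnf] [dg dng]; split=> [p|v]; first exact: differentiable_pair.
apply: (@eq_Ck _ _ _ (fun p => ('D_v f p, 'D_v g p))) => [p|].
  by symmetry; exact: derive_pair.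
by apply: IHn; [exact: dnf|exact: dng].
Qed.

(** By the chain rule f is differentiated in the direction ['D_v c p], which varies with p, whereas
    [Ck] speaks of fixed directions. Expanding in the standard basis leaves sums and products of
    scalar functions, to which the induction applies. *)
Lemma Ck_comp (V : normedModType R) n (f : R * R -> R) (c : V -> R * R) :
  Ck n f -> Ck n c -> Ck n (fun p => f (c p)).
Proof.
elim: n f c => [|n IHn] f c.
  by move=> cf cc p; apply: (@continuous_comp _ _ _ c f); [exact: cc|exact: cf].
move=> [df dnf] /[dup] /CkS Cc [dc dnc].
split=> [p|v]; first by apply: (@differentiable_comp _ _ _ _ c f).
apply: (@eq_Ck _ _ _ (fun p => ('D_v c p).1 * 'D_(1, 0) f (c p)
                               + ('D_v c p).2 * 'D_(0, 1) f (c p))) => [p|].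
  by symmetry; rewrite -[LHS]/('D_v (f \o c) p) derive_comp// derive_coord.
apply: CkD; apply: CkM; [exact/Ck_fst/dnc| |exact/Ck_snd/dnc|].
  by apply: (IHn (fun q => 'D_(1, 0) f q)) => //; exact: dnf.
by apply: (IHn (fun q => 'D_(0, 1) f q)) => //; exact: dnf.
Qed.

Lemma Ck_comp2 (V : normedModType R) n (f : R * R -> R * R) (c : V -> R * R) :
  Ck n f -> Ck n c -> Ck n (fun p => f (c p)).
Proof.
move=> Cf Cc.
apply: (@eq_Ck _ _ _ (fun p => ((f (c p)).1, (f (c p)).2))) => [p|].
  by case: (f (c p)).
apply: Ck_pair; first exact: (Ck_comp (Ck_fst Cf) Cc).
exact: (Ck_comp (Ck_snd Cf) Cc).
Qed.

Lemma Ck_line (V : normedModType R) n (y w : V) : Ck n (fun t : R => y + t *: w).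
Proof.
case: n => [|n]; first by move=> t; exact/differentiable_continuous/differentiable_line.
split=> [t|v]; first exact: differentiable_line.
apply: (@eq_Ck _ _ _ (fun=> v *: w)) => [t|]; last exact: Ck_cst.
by symmetry; apply: derive_line.
Qed.

End CkTheory.

(** * Symmetry of second derivatives *)

Section Schwarz.
Context {R : realType}.

Lemma MVT_line (V : normedModType R) (h : V -> R) (y w : V) (s : R) : 0 < s ->
  (forall q, differentiable h q) ->
  exists2 c, 0 <= c <= s & h (y + s *: w) - h y = s * 'D_w h (y + c *: w).
Proof.
move=> s0 dh.
have dl t := is_derive_line (dh (y + t *: w)).
have [|c cs] := @MVT_segment _ (fun t => h (y + t *: w)) _ 0 s (ltW s0) (fun t _ => dl t).
  apply: continuous_subspaceT => t.
  by apply/differentiable_continuous/derivable1_diffP; case: (dl t).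
rewrite scale0r addr0 subr0 mulrC => e; by exists c.
Qed.

(* Both mixed derivatives are close to the second difference quotient of b on
   the small parallelogram spanned by s *: u and s *: v. *)
Lemma derive_swap (V : normedModType R) (b : V -> R) (u v : V) p : Ck 2 b ->
  'D_u (fun q => 'D_v b q) p = 'D_v (fun q => 'D_u b q) p.
Proof.
move=> [db dnb].
(* The mean value theorem is used once along x, on the first difference h of b along y, and once
   along y, on the derivative along x. The left side is symmetric in x and y, so it can be evaluated
   in both orders. *)
have mixed (x y : V) s : 0 < s -> exists c, exists2 d, (0 <= c <= s) && (0 <= d <= s) &
    b (p + s *: x + s *: y) - b (p + s *: x) - (b (p + s *: y) - b p)
    = s * (s * 'D_y (fun q => 'D_x b q) (p + c *: x + d *: y)).
  move=> s0; pose h q := b (q + s *: y) - b q.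
  have dsh q : differentiable (fun q => b (q + s *: y)) q.
    by apply: (@differentiable_comp _ _ _ _ (fun q => q + s *: y) b).
  have dh q : differentiable h q by apply: differentiableB.
  have [c cs hc] := MVT_line p x s0 dh.
  have [d ds hd] := MVT_line (p + c *: x) y s0 (dnb x).1.
  exists c; exists d; first by rewrite cs ds.
  rewrite -hd; rewrite /h in hc.
  rewrite hc; congr (_ * _).
  rewrite deriveB; [|exact: diff_derivable..]; congr (_ - _).
  rewrite -[LHS]/('D_x (b \o (fun q => q + s *: y)) _) derive_comp//.
  congr ('D__ b _).
  by rewrite deriveD// derive_id derive_cst addr0.
have cont (x y : V) := (dnb x).2 y p.
apply/eqP; rewrite -subr_eq0 -normr_le0; apply/ler_addgt0Pr => e e0.
have e20 : 0 < e / 2 by rewrite divr_gt0.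
have near_p (x y : V) : \forall s \near 0^'+, forall c d, 0 <= c <= s -> 0 <= d <= s ->
    `|'D_y (fun q => 'D_x b q) p - 'D_y (fun q => 'D_x b q) (p + c *: x + d *: y)| < e / 2.
  have /cvgrPdist_lt /(_ _ e20) /nbhs_ballP[r /= r0 hr] := cont x y.
  near=> s => c d /andP[c0 cs] /andP[d0 ds]; apply: hr.
  rewrite -ball_normE /= opprD addrA opprD addrA subrr add0r -opprD normrN.
  rewrite (le_lt_trans (ler_normD _ _))// !normrZ !ger0_norm//.
  apply: (@le_lt_trans _ _ (s * `|x| + s * `|y|)); first by rewrite lerD// ler_wpM2r.
  (* The extra 1 keeps the divisor positive when both vectors vanish. *)
  have k0 : 0 < `|x| + `|y| + 1 by rewrite ltr_wpDl// addr_ge0.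
  apply: (@le_lt_trans _ _ (s * (`|x| + `|y| + 1))).
    rewrite -mulrDr ler_wpM2l ?lerDl//.
  by rewrite -ltr_pdivlMr//; near: s; apply: nbhs_right_lt; rewrite divr_gt0.
have [s [[nu nv] s0]] := filter_ex (filterI (filterI (near_p v u) (near_p u v))
  (nbhs_right_gt (0 : R))).
have [c [d /andP[cs ds] euv]] := mixed v u s s0.
have [c' [d' /andP[cs' ds'] evu]] := mixed u v s s0.
have /(mulfI (lt0r_neq0 s0)) /(mulfI (lt0r_neq0 s0)) E :
    s * (s * 'D_u (fun q => 'D_v b q) (p + c *: v + d *: u)) =
    s * (s * 'D_v (fun q => 'D_u b q) (p + c' *: u + d' *: v)).
  by rewrite -euv -evu (addrAC p (s *: v)) !opprB addrACA [in RHS]addrACA;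
    congr (_ + _); exact: addrC.
have := nu c d cs ds; have := nv c' d' cs' ds'; rewrite E => n1 n2.
rewrite add0r; apply: ltW.
set a := 'D_u _ p in n2 *; set a' := 'D_v _ p in n1 *.
set m := 'D_v _ (_ + _) in n1 n2.
rewrite (_ : a - a' = (a - m) - (a' - m)); last ring.
apply: (le_lt_trans (ler_normB _ _)); rewrite (splitr e); exact: (ltrD n2 n1).
Unshelve. all: end_near.
Qed.
End Schwarz.

(** * Integrals of Jacobian determinants *)

Section Jacobian.
Context {R : realType}.
Implicit Types (a b h : R * R -> R) (p v : R * R).
Notation mu := (@lebesgue_measure R).
Notation mu2 := ((mu \x mu)%E).
Notation I01 := (`[0%R, 1%R]%classic : set R).
Notation Q := (I01 `*` I01).

Definition jacobian2 a b p : R :=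
  'D_(1, 0) a p * 'D_(0, 1) b p - 'D_(0, 1) a p * 'D_(1, 0) b p.

Lemma pair_line1 (x y : R) : (x, y) = (0, y) + x *: (1, 0) :> R * R.
Proof.
by congr pair; [rewrite -[RHS]/(0 + x * 1) mulr1 add0r | rewrite -[RHS]/(y + x * 0) mulr0 addr0].
Qed.

Lemma pair_line2 (x y : R) : (x, y) = (x, 0) + y *: (0, 1) :> R * R.
Proof.
by congr pair; [rewrite -[RHS]/(x + y * 0) mulr0 addr0 | rewrite -[RHS]/(0 + y * 1) mulr1 add0r].
Qed.

Lemma is_derive_slice1 h (x y : R) : differentiable h (x, y) ->
  is_derive x (1 : R) (fun x => h (x, y)) ('D_(1, 0) h (x, y)).
Proof.
rewrite [in differentiable _ _](pair_line1 x y) [in 'D__ h _](pair_line1 x y) => dh.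
rewrite (_ : (fun x => h (x, y)) = fun s => h ((0, y) + s *: (1, 0))).
  exact: is_derive_line.
by apply/funext => z; rewrite -pair_line1.
Qed.

Lemma is_derive_slice2 h (x y : R) : differentiable h (x, y) ->
  is_derive y (1 : R) (fun y => h (x, y)) ('D_(0, 1) h (x, y)).
Proof.
rewrite [in differentiable _ _](pair_line2 x y) [in 'D__ h _](pair_line2 x y) => dh.
rewrite (_ : (fun y => h (x, y)) = fun s => h ((x, 0) + s *: (0, 1))).
  exact: is_derive_line.
by apply/funext => z; rewrite -pair_line2.
Qed.

Lemma Rintegral_square_D1 h : Ck 1 h ->
  \int[mu2]_(p in Q) 'D_(1, 0) h p = \int[mu]_(y in I01) (h (1, y) - h (0, y)).
Proof.
move=> [dh ch]; rewrite Rintegral_square21; last exact: ch.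
apply: eq_Rintegral => y _; apply: (Rintegral_I01_derive (F := fun x => h (x, y))).
  exact: (continuous_pairl (ch (1, 0))).
by move=> x _; exact: is_derive_slice1.
Qed.

Lemma Rintegral_square_D2 h : Ck 1 h ->
  \int[mu2]_(p in Q) 'D_(0, 1) h p = \int[mu]_(x in I01) (h (x, 1) - h (x, 0)).
Proof.
move=> [dh ch]; rewrite Rintegral_square12; last exact: ch.
apply: eq_Rintegral => x _; apply: (Rintegral_I01_derive (F := fun y => h (x, y))).
  exact: (continuous_pairr (ch (0, 1))).
by move=> y _; exact: is_derive_slice2.
Qed.

Lemma derive_shift_invariant h v p w (c : R) : (forall q, differentiable h q) ->
  (forall q, h (q + w) = h q + c) -> 'D_v h (p + w) = 'D_v h p.
Proof.
move=> dh hw.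
have dw q : differentiable (fun q : R * R => q + w) q by [].
have -> : 'D_v h (p + w) = 'D_v (h \o (fun q => q + w)) p.
  rewrite (derive_comp v (dw p) (dh (p + w))) deriveD ?derive_id ?derive_cst ?addr0//.
rewrite (_ : h \o _ = h + cst c); last by apply/funext => q; exact: hw.
rewrite deriveD; [by rewrite derive_cst addr0|exact/diff_derivable/dh|exact: derivable_cst].
Qed.

(** The form da db is exact with primitive a db, by symmetry of the second derivatives of b, so only
    the boundary of the square contributes. On opposite sides db agrees and a differs by a constant;
    what remains is a1 times the increment of b along the left side minus a2 times its increment
    along the bottom. *)
Lemma Rintegral_jacobian2 a b (a1 a2 b1 b2 : R) : Ck 1 a -> Ck 2 b ->
  (forall p, a (p + (1, 0)) = a p + a1) -> (forall p, a (p + (0, 1)) = a p + a2) ->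
  (forall p, b (p + (1, 0)) = b p + b1) -> (forall p, b (p + (0, 1)) = b p + b2) ->
  \int[mu2]_(p in Q) jacobian2 a b p = a1 * b2 - a2 * b1.
Proof.
move=> Ca Cb ha1 ha2 hb1 hb2.
have [da ca] := Ca; have [db dnb] := Cb.
have C1 : Ck 1 (fun p => a p * 'D_(0, 1) b p) := CkM Ca (dnb (0, 1)).
have C2 : Ck 1 (fun p => a p * 'D_(1, 0) b p) := CkM Ca (dnb (1, 0)).
have J p : jacobian2 a b p = 'D_(1, 0) (fun p => a p * 'D_(0, 1) b p) p
                           - 'D_(0, 1) (fun p => a p * 'D_(1, 0) b p) p.
  have ddb v q : differentiable (fun p => 'D_v b p) q := (dnb v).1 q.
  have DM u v : 'D_u (fun p => a p * 'D_v b p) p =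
      a p * 'D_u (fun p => 'D_v b p) p + 'D_v b p * 'D_u a p.
    by apply: deriveM; exact: diff_derivable.
  rewrite (DM (1, 0) (0, 1)) (DM (0, 1) (1, 0))
    (@derive_swap _ _ b ((0, 1) : R * R) ((1, 0) : R * R) p Cb) /jacobian2
    opprD addrACA subrr add0r.
  by congr (_ - _); exact: mulrC.
transitivity (\int[mu2]_(p in Q) ('D_(1, 0) (fun p => a p * 'D_(0, 1) b p) p
    - 'D_(0, 1) (fun p => a p * 'D_(1, 0) b p) p)).
  by apply: eq_Rintegral => p _; exact: J.
transitivity (\int[mu]_(y in I01) (a (1, y) * 'D_(0, 1) b (1, y) - a (0, y) * 'D_(0, 1) b (0, y))
  - \int[mu]_(x in I01) (a (x, 1) * 'D_(1, 0) b (x, 1) - a (x, 0) * 'D_(1, 0) b (x, 0))).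
  rewrite -(Rintegral_square_D1 C1) -(Rintegral_square_D2 C2).
  apply: RintegralB.
  - exact: measurable_square.
  - exact/continuous_integrable_square/C1.2.
  - exact/continuous_integrable_square/C2.2.
have e1 (y : R) : (1, y) = (0, y) + (1, 0) :> R * R.
  by congr pair; [rewrite -[RHS]/(0 + 1) add0r|rewrite -[RHS]/(y + 0) addr0].
have e2 (x : R) : (x, 1) = (x, 0) + (0, 1) :> R * R.
  by congr pair; [rewrite -[RHS]/(x + 0) addr0|rewrite -[RHS]/(0 + 1) add0r].
have -> : \int[mu]_(y in I01) (a (1, y) * 'D_(0, 1) b (1, y) - a (0, y) * 'D_(0, 1) b (0, y))
        = \int[mu]_(y in I01) (a1 * 'D_(0, 1) b (0, y)).
  apply: eq_Rintegral => y _.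
  by rewrite e1 (derive_shift_invariant _ _ db hb1) ha1 mulrDl addrC addKr.
have -> : \int[mu]_(x in I01) (a (x, 1) * 'D_(1, 0) b (x, 1) - a (x, 0) * 'D_(1, 0) b (x, 0))
        = \int[mu]_(x in I01) (a2 * 'D_(1, 0) b (x, 0)).
  apply: eq_Rintegral => x _.
  by rewrite e2 (derive_shift_invariant _ _ db hb2) ha2 mulrDl addrC addKr.
have cb v : continuous (fun p => 'D_v b p) by move=> p; exact/differentiable_continuous/(dnb v).1.
have i1 := continuous_pairr (x := 0) (cb (0, 1)).
have i2 := continuous_pairl (y := 0) (cb (1, 0)).
rewrite !RintegralZl//; [|exact: continuous_integrable_I01..].
rewrite (Rintegral_I01_derive (F := fun y => b (0, y)) i1
  (fun y _ => is_derive_slice2 (db (0, y)))).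
rewrite (Rintegral_I01_derive (F := fun x => b (x, 0)) i2
  (fun x _ => is_derive_slice1 (db (x, 0)))).
by rewrite e2 e1 hb1 hb2 [b _ + b1]addrC [b _ + b2]addrC !addrK.
Qed.

End Jacobian.

(** * Hermite's inequality *)

Section Hermite.
Context {R : realType}.
Implicit Types (A B : R * R).

Definition det2 A B : R := A.1 * B.2 - A.2 * B.1.

Definition lattice_point A B (m n : int) : R * R := m%:~R *: A + n%:~R *: B.

Lemma lattice_point1 A B m n : (lattice_point A B m n).1 = m%:~R * A.1 + n%:~R * B.1.
Proof. by []. Qed.

Lemma lattice_point2 A B m n : (lattice_point A B m n).2 = m%:~R * A.2 + n%:~R * B.2.
Proof. by []. Qed.

(** Outside the box [-N, N]^2 the values of F exceed F m0 n0, so a minimiser among the finitely many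
    points of P in the box is a global one. *)
Lemma exists_min_int2 (P : int -> int -> Prop) (F : int -> int -> R) (m0 n0 : int) (N : nat) :
  P m0 n0 ->
  (forall m n, F m n <= F m0 n0 -> (`|m| <= N)%N /\ (`|n| <= N)%N) ->
  exists m n, P m n /\ forall m' n', P m' n' -> F m n <= F m' n'.
Proof.
move=> P0 FN.
(* The interval [-N, N] has 2 N + 1 integers, numbered from 0 by a shift of N. *)
pose z (i : 'I_(N + N).+1) : int := i%:Z - N%:Z.
have zP (m : int) : (`|m| <= N)%N -> exists i, z i = m.
  move=> mN; have lt : (absz (m + N%:Z)%R < (N + N).+1)%N by lia.
  by exists (Ordinal lt); rewrite /z /=; lia.
have [m0N n0N] := FN _ _ (lexx (F m0 n0)).
have [i0 i0E] := zP _ m0N; have [j0 j0E] := zP _ n0N.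
pose PP (i : 'I_(N + N).+1 * 'I_(N + N).+1) := `[< P (z i.1) (z i.2) >].
have PP0 : PP (i0, j0) by apply/asboolP; rewrite /= i0E j0E.
case: (Order.TotalTheory.arg_minP (fun i => F (z i.1) (z i.2)) PP0) => -[i j] /asboolP Pij min.
exists (z i), (z j); split => // m' n' P'.
have [le|/ltW gt] := leP (F m' n') (F m0 n0).
  have [m'N n'N] := FN _ _ le.
  have [i' i'E] := zP _ m'N; have [j' j'E] := zP _ n'N.
  rewrite -i'E -j'E; apply: (min (i', j')).
  by apply/asboolP; rewrite /= i'E j'E.
apply: le_trans gt; rewrite -i0E -j0E; exact: (min (i0, j0)).
Qed.

Lemma sqr_int_bound (m : int) (N : nat) : (m%:~R ^+ 2 : R) <= N%:R -> (`|m| <= N)%N.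
Proof.
rewrite -rmorphXn/= -[N%:R]/((N%:Z)%:~R) ler_int; nia.
Qed.

(** Cauchy-Schwarz with its defect. It bounds lattice coordinates, drives Hermite's inequality, and
    turns the Gram determinant of a pulled-back metric into a squared Jacobian. *)
Lemma lagrange_id (v w : R * R) : dot v v * dot w w = dot v w ^+ 2 + det2 v w ^+ 2.
Proof. rewrite /dot /det2; ring. Qed.

Lemma dot_ge0 (v : R * R) : 0 <= dot v v.
Proof. by rewrite /dot -!expr2 addr_ge0// sqr_ge0. Qed.

Lemma det2_lattice_point A B (m n m' n' : int) :
  det2 (lattice_point A B m n) (lattice_point A B m' n') = (m * n' - n * m')%:~R * det2 A B.
Proof.
by rewrite /det2 !lattice_point1 !lattice_point2 rmorphB/= !intrM; ring.
Qed.

Lemma det2_lattice_point_l A B m n : det2 (lattice_point A B m n) B = m%:~R * det2 A B.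
Proof. by rewrite /det2 lattice_point1 lattice_point2; ring. Qed.

Lemma det2_lattice_point_r A B m n : det2 (lattice_point A B m n) A = - n%:~R * det2 A B.
Proof. by rewrite /det2 lattice_point1 lattice_point2; ring. Qed.

Lemma dot_lattice_point_gt0 A B m n : det2 A B != 0 -> (m != 0) || (n != 0) ->
  0 < dot (lattice_point A B m n) (lattice_point A B m n).
Proof.
move=> D0 mn; rewrite lt0r dot_ge0 andbT; apply/eqP => w0.
have w_det C : det2 (lattice_point A B m n) C = 0.
  have /esym/eqP := lagrange_id (lattice_point A B m n) C.
  by rewrite w0 mul0r paddr_eq0 ?sqr_ge0// !sqrf_eq0 => /andP[_ /eqP].
move: (w_det B) (w_det A); rewrite det2_lattice_point_l det2_lattice_point_r.
move=> /eqP + /eqP; rewrite !mulf_eq0 oppr_eq0 !intr_eq0 (negbTE D0) !orbF => m0 n0.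
by move: mn; rewrite m0 n0.
Qed.

(** The squared length q is minimised over primitive vectors, those which extend to a lattice basis:
    this is [P]. A shortest one v has a complement w, reduced modulo v so that |dot v w| <= q / 2.
    As w is primitive too, q <= dot w w, and Lagrange's identity gives q^2 <= q * dot w w = (dot v
    w)^2 + 1 <= q^2 / 4 + 1, whence 4 / 3. *)
Lemma hermite_constant2 A B : `|det2 A B| = 1 ->
  exists m n : int, ((m != 0) || (n != 0)) /\
    dot (lattice_point A B m n) (lattice_point A B m n) ^+ 2 <= 4 / 3.
Proof.
move=> det1.
have det12 : det2 A B ^+ 2 = 1 by rewrite -real_normK ?num_real// det1 expr1n.
pose F m n := dot (lattice_point A B m n) (lattice_point A B m n).
pose P (m n : int) := exists m' n' : int, m * n' - n * m' = 1.
have P10 : P 1 0 by exists 0, 1; lia.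
(* By Cramer's rule and |det2 A B| = 1, the coordinates m and n of a vector v are, up to sign, its
   determinants with B and A. Their squares are thus at most |v|^2 |B|^2 and |v|^2 |A|^2; N
   dominates both when |v|^2 <= F 1 0. *)
have [N hN] : exists N : nat, dot A A * F 1 0 + dot B B * F 1 0 <= N%:R.
  by exists (Num.truncn (dot A A * F 1 0 + dot B B * F 1 0)).+1; rewrite ltW// truncnS_gt.
have bound m n : F m n <= F 1 0 -> (`|m| <= N)%N /\ (`|n| <= N)%N.
  move=> le.
  have bnd (C : R * R) : det2 (lattice_point A B m n) C ^+ 2 <= dot C C * F 1 0.
    apply: (@le_trans _ _ (F m n * dot C C)).
      by rewrite lagrange_id lerDr sqr_ge0.
    by rewrite mulrC ler_wpM2l// dot_ge0.
  have F0 : 0 <= F 1 0 by exact: dot_ge0.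
  split; apply: sqr_int_bound; apply: le_trans hN.
    have := bnd B; rewrite det2_lattice_point_l exprMn det12 mulr1.
    by move=> /le_trans; apply; rewrite lerDr mulr_ge0// dot_ge0.
  have := bnd A; rewrite det2_lattice_point_r exprMn det12 mulr1 sqrrN.
  by move=> /le_trans; apply; rewrite lerDl mulr_ge0// dot_ge0.
have [m [n [[m' [n' mn1]] min]]] := exists_min_int2 P10 bound.
exists m, n; split.
  by apply: contraT; rewrite negb_or !negbK => /andP[/eqP m0 /eqP n0]; lia.
rewrite -/(F m n); set q := F m n.
set v := lattice_point A B m n.
(* An integer nearest to the quotient, so that subtracting k v leaves a remainder of at most q /
   2. *)
pose k := Num.floor (dot v (lattice_point A B m' n') / q + 1 / 2).
pose w := lattice_point A B (m' - k * m) (n' - k * n).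
have qge0 : 0 <= q by exact: dot_ge0.
have det1' : det2 v w ^+ 2 = 1.
  rewrite det2_lattice_point exprMn det12 mulr1.
  by rewrite (_ : m * _ - _ = 1) ?expr1n//; lia.
have le_qw : q <= dot w w by apply: min; exists (- m), (- n); lia.
have [q0|qn0] := eqVneq q 0; first by rewrite q0 expr0n/= divr_ge0.
have qgt0 : 0 < q by rewrite lt0r qn0.
have dvw : dot v w = dot v (lattice_point A B m' n') - k%:~R * q.
  rewrite /q /F -/v /w.
  rewrite /dot !lattice_point1 !lattice_point2 !rmorphB/= !intrM; ring.
have small : dot v w ^+ 2 <= q ^+ 2 / 4.
  have /andP[k1 k2] := floor_itv (dot v (lattice_point A B m' n') / q + 1 / 2).
  rewrite -/k in k1 k2.
  set d := dot v (lattice_point A B m' n') in dvw k1 k2.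
  have dq : d = d / q * q by rewrite divfK.
  rewrite dvw dq -mulrBl exprMn mulrC ler_wpM2l ?sqr_ge0//.
  rewrite intrD in k2.
  set x := d / q in k1 k2 *.
  nra.
have := lagrange_id v w; rewrite det1' -/q => lag.
have : q * q <= q * dot w w by rewrite ler_wpM2l.
rewrite -/(F m n) -/q in lag.
rewrite lag expr2; move: small; rewrite expr2 expr2; lra.
Qed.
End Hermite.

(** * Loops and deck translations *)

Section Topology.
Context {R : realType}.
Implicit Types (p q z : R * R).
Notation I01 := (`[0%R, 1%R]%classic : set R).
Notation Q := (I01 `*` I01).

(** If the end values differed, the intermediate value theorem would give a value k + 1/2 with k an
    integer; doubling contradicts parity. *)
Lemma int_valued_const (f : R -> R) : {within I01, continuous f} ->
  (forall t, 0 <= t <= 1 -> exists k : int, f t = k%:~R) -> f 1 = f 0.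
Proof.
move=> cf fi.
have [i i0] := fi 0 ltac:(by rewrite lexx ler01).
have [j j1] := fi 1 ltac:(by rewrite lexx ler01).
have half (k : int) : Num.min (f 0) (f 1) <= k%:~R + 1 / 2 <= Num.max (f 0) (f 1) -> False.
  move=> /(IVT ler01 cf)[c]; rewrite in_itv/= => /fi[l ->] lk.
  have : (2 * l)%:~R = (2 * k + 1)%:~R :> R by rewrite intrD !intrM lk; lra.
  by move/intr_inj; lia.
case: (ltgtP i j) => [ij|ji|ij]; last by rewrite i0 j1 ij.
- exfalso; apply: (half i).
  have : (i + 1)%:~R <= j%:~R :> R by rewrite ler_int; lia.
  rewrite intrD => ij1; rewrite i0 j1 min_l ?max_r; lra.
- exfalso; apply: (half j).
  have : (j + 1)%:~R <= i%:~R :> R by rewrite ler_int; lia.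
  rewrite intrD => ij1; rewrite i0 j1 min_r ?max_l; lra.
Qed.

Lemma std_lattice_point (m n : int) :
  m%:~R *: (1, 0) + n%:~R *: (0, 1) = (m%:~R, n%:~R) :> R * R.
Proof.
congr pair; first by rewrite -[LHS]/(m%:~R * 1 + n%:~R * 0) mulr1 mulr0 addr0.
by rewrite -[LHS]/(m%:~R * 0 + n%:~R * 1) mulr1 mulr0 add0r.
Qed.

Lemma Z2P z : Z2 z <-> exists m n : int, z = (m%:~R, n%:~R).
Proof.
by split=> -[m [n ->]]; exists m, n; rewrite std_lattice_point.
Qed.

Lemma Z2_path_const (d : R -> R * R) : {within I01, continuous d} ->
  (forall t, 0 <= t <= 1 -> Z2 (d t)) -> d 1 = d 0.
Proof.
move=> cd Zd; rewrite [LHS]surjective_pairing [RHS]surjective_pairing; congr pair.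
  apply: (@int_valued_const (fun t => (d t).1)).
    by move=> t; apply: (cvg_comp _ _ (cd t)); exact: cvg_fst.
  by move=> t /Zd/Z2P[m [n ->]]; exists m.
apply: (@int_valued_const (fun t => (d t).2)).
  by move=> t; apply: (cvg_comp _ _ (cd t)); exact: cvg_snd.
by move=> t /Zd/Z2P[m [n ->]]; exists n.
Qed.

(** The displacement H (s, 1) - H (s, 0) is continuous in s and integral, hence constant. At s = 1
    it vanishes: the lift of a constant loop stays in one orbit of [Z2], so it does not move. *)
Lemma contractible_loop_closed (c : R -> R * R) : contractible_loop c -> c 1 = c 0.
Proof.
move=> [H [cH H0 Hs Ht]].
have I0 : 0 <= (0 : R) <= 1 by rewrite lexx ler01.
have I1 : 0 <= (1 : R) <= 1 by rewrite lexx ler01.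
have QH s t : 0 <= s <= 1 -> 0 <= t <= 1 -> Q (s, t) by move=> ? ?; split; rewrite /= in_itv.
have path (l : R -> R * R) : continuous l -> (forall t, 0 <= t <= 1 -> Q (l t)) ->
    {within I01, continuous (fun t => H (l t))}.
  move=> cl lQ; apply/subspace_continuousP => t; rewrite /= in_itv/= => It.
  move/subspace_continuousP : cH => /(_ _ (lQ _ It)) cH.
  apply: (cvg_comp _ _ _ cH) => U nU.
  have : nbhs t (fun s => Q (l s) -> U (l s)) := cl t _ nU.
  rewrite -[X in _ -> X]/(nbhs t (fun s => I01 s -> U (l s))).
  by apply: filterS => s QU Is; apply: QU; apply: lQ; rewrite /= in_itv in Is.
have cpl (y : R) : continuous (fun s : R => (s, y)).
  by move=> s; apply: pair_continuous_at; [|exact: cst_continuous].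
have cpr (x : R) : continuous (fun t : R => (x, t)).
  by move=> t; apply: pair_continuous_at; [exact: cst_continuous|].
have e0 : H (0, 1) - H (0, 0) = H (1, 1) - H (1, 0).
  symmetry; apply: (@Z2_path_const (fun s => H (s, 1) - H (s, 0))) => // t.
  - exact: (cvgB (path _ (cpl 1) (fun s Is => QH s 1 Is I1) t)
                 (path _ (cpl 0) (fun s Is => QH s 0 Is I0) t)).
have e1 : H (1, 1) - H (1, 0) = 0.
  rewrite -[RHS](subrr (H (1, 0))).
  apply: (@Z2_path_const (fun t => H (1, t) - H (1, 0))) => // t.
  - exact: (cvgB (path _ (cpr 1) (fun t It => QH 1 t I1 It) t) (cvg_cst (H (1, 0)))).
by apply/eqP; rewrite -subr_eq0 -!H0// e0 e1.
Qed.

(** A change of sign between 0 and p would force a zero on the segment joining them. The factor e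
    makes the area density |J| a constant multiple of J, to which the integral formulas for
    Jacobians apply. *)
Lemma constant_sign (J : R * R -> R) : continuous J -> (forall p, J p != 0) ->
  exists2 e : R, `|e| = 1 & forall p, `|J p| = e * J p.
Proof.
move=> cJ J0; exists (Num.sg (J 0)); first by rewrite normr_sg J0.
move=> p; rewrite normrEsg; congr (_ * _).
have cl : {within I01, continuous (fun t : R => J (t *: p))}.
  apply: continuous_subspaceT => t; apply: (@continuous_comp _ _ _ (fun t : R => t *: p) J).
    exact: (@cvgZr_tmp).
  exact: cJ.
have [//|ne] := eqVneq (Num.sg (J p)) (Num.sg (J 0)).
have [] := IVT (v := 0) ler01 cl.
  rewrite scale0r scale1r.
  case: (ltgtP (J p) 0) (J0 p) ne => // sp _; case: (ltgtP (J 0) 0) (J0 0) => // s0 _;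
    rewrite ?(ltr0_sg sp) ?(gtr0_sg sp) ?(ltr0_sg s0) ?(gtr0_sg s0) ?eqxx// => _.
    by rewrite min_r ?max_l; lra.
  by rewrite min_l ?max_r; lra.
by move=> t _ Jt; move: (J0 (t *: p)); rewrite Jt eqxx.
Qed.

Lemma shift_int (T W : zmodType) (h : T -> W) (a : T) (c : W) :
  (forall x, h (x + a) = h x + c) -> forall (m : int) x, h (x + a *~ m) = h x + c *~ m.
Proof.
move=> ha; have pos (n : nat) x : h (x + a *+ n) = h x + c *+ n.
  elim: n x => [|n IHn] x; first by rewrite !mulr0n !addr0.
  by rewrite mulrS addrA IHn ha -addrA -mulrS.
case=> n x; first exact: pos.
by rewrite NegzE !mulrNz -[in RHS](subrK (a *+ n.+1) x) pos addrK.
Qed.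

Lemma periodic_bounded (h : R * R -> R) : continuous h ->
  (forall p, h (p + (1, 0)) = h p) -> (forall p, h (p + (0, 1)) = h p) ->
  exists M, forall p, `|h p| <= M.
Proof.
move=> ch h1 h2; have [M hM] := continuous_bounded_square ch.
exists M => p.
pose q : R * R := p - ((1, 0) *~ Num.floor p.1 + (0, 1) *~ Num.floor p.2).
have -> : h p = h q.
  have h10 x : h (x + (1, 0)) = h x + 0 by rewrite addr0.
  have h20 x : h (x + (0, 1)) = h x + 0 by rewrite addr0.
  have := shift_int h20 (Num.floor p.2) (q + (1, 0) *~ Num.floor p.1).
  by rewrite (shift_int h10) !mul0rz !addr0 -addrA subrK.
apply: hM.
have fr (x : R) : 0 <= x - (Num.floor x)%:~R <= 1.
  by have /andP[] := floor_itv x; rewrite intrD; lra.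
have E := std_lattice_point (Num.floor p.1) (Num.floor p.2).
have -> : q = p - ((Num.floor p.1)%:~R, (Num.floor p.2)%:~R).
  by rewrite /q -E; congr (_ - (_ + _)); rewrite -scaler_int.
by split; rewrite /= in_itv/=; [exact: (fr p.1)|exact: (fr p.2)].
Qed.
End Topology.

Section Deck.
Context {R : realType}.
Implicit Types (a b p q z : R * R).

Lemma lattice_path_const a b (d : R -> R * R) : lattice_basis a b -> continuous d ->
  (forall t, lattice a b (d t)) -> d 1 = d 0.
Proof.
move=> ab cd Ld; have D0 : a.1 * b.2 - a.2 * b.1 != 0 by exact: ab.
set D := a.1 * b.2 - a.2 * b.1 in D0.
(* Cramer's rule: [l1] and [l2] are the coordinates in the basis a, b, which are integers on the
   lattice. *)
pose l1 p : R := (p.1 * b.2 - p.2 * b.1) / D.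
pose l2 p : R := (a.1 * p.2 - a.2 * p.1) / D.
have l12 (m n : int) : l1 (m%:~R *: a + n%:~R *: b) = m%:~R /\
                       l2 (m%:~R *: a + n%:~R *: b) = n%:~R.
  rewrite /l1 /l2.
  rewrite -![(_ + _).1]/(m%:~R * a.1 + n%:~R * b.1).
  rewrite -![(_ + _).2]/(m%:~R * a.2 + n%:~R * b.2).
  by split; rewrite /D; field.
have cd1 : continuous (fun t => (d t).1).
  by move=> t; apply: (cvg_comp _ _ (cd t)); exact: cvg_fst.
have cd2 : continuous (fun t => (d t).2).
  by move=> t; apply: (cvg_comp _ _ (cd t)); exact: cvg_snd.
have e1 : l1 (d 1) = l1 (d 0).
  apply: (int_valued_const (f := fun t => l1 (d t))).
    apply: continuous_subspaceT => t; apply: cvgM; last exact: cvg_cst.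
    by apply: cvgB; apply: cvgM; [exact: cd1|exact: cvg_cst|exact: cd2|exact: cvg_cst].
  by move=> t _; have [m [n ->]] := Ld t; exists m; rewrite (l12 m n).1.
have e2 : l2 (d 1) = l2 (d 0).
  apply: (int_valued_const (f := fun t => l2 (d t))).
    apply: continuous_subspaceT => t; apply: cvgM; last exact: cvg_cst.
    by apply: cvgB; apply: cvgM; [exact: cvg_cst|exact: cd2|exact: cvg_cst|exact: cd1].
  by move=> t _; have [m [n ->]] := Ld t; exists n; rewrite (l12 m n).2.
have [m [n dmn]] := Ld 1; have [m' [n' dmn']] := Ld 0.
move: e1 e2; rewrite dmn dmn' !(l12 _ _).1 !(l12 _ _).2.
by move=> -> ->.
Qed.

(** Along the segment from 0 to p the difference phi (t p + z) - phi (t p) is continuous with values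
    in the lattice, so its values at 0 and at p agree. *)
Lemma flat_deck a b (phi : R * R -> R * R) z : lattice_basis a b -> continuous phi ->
  (forall p q, Z2 (p - q) <-> lattice a b (phi p - phi q)) -> Z2 z ->
  exists A, forall p, phi (p + z) = phi p + A.
Proof.
move=> ab cphi hphi Zz; exists (phi z - phi 0) => p.
pose d (t : R) := phi (t *: p + z) - phi (t *: p).
have cd : continuous d.
  have cline y : continuous (fun t : R => phi (t *: p + y)).
    move=> t; apply: (@continuous_comp _ _ _ (fun t : R => t *: p + y) phi); last exact: cphi.
    by apply: cvgD; [exact: scalel_continuous|exact: cvg_cst].
  move=> t; apply: cvgB; first exact: cline.
  apply: (@continuous_comp _ _ _ (fun t : R => t *: p) phi); last exact: cphi.
  exact: scalel_continuous.
have Ld t : lattice a b (d t) by apply/hphi; rewrite addrC addKr.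
have := lattice_path_const ab cd Ld; rewrite /d scale1r scale0r add0r => <-.
by rewrite [RHS]addrC subrK.
Qed.

End Deck.

(** * Comparison of an integral with its left Riemann sums *)

Section RiemannSum.
Context {R : realType}.
Notation mu := (@lebesgue_measure R).
Notation I01 := (`[0%R, 1%R]%classic : set R).

Lemma exists_primitive_I01 (h : R -> R) : continuous h ->
  exists F : R -> R, forall t : R, 0 <= t <= 1 -> is_derive t 1 F (h t).
Proof.
move=> ch; pose F x := \int[mu]_(t in `[(-1), x]) h t.
exists F => t /andP[t0 t1].
have ih : mu.-integrable `[(-1), 2] (EFin \o h).
  apply: continuous_compact_integrable; first exact: segment_compact.
  exact: continuous_subspaceT.
have t2 : t < 2 by lra.
have t_1 : -1 < t by lra.
have [dF F't] := continuous_FTC1_closed t2 ih t_1 (ch t).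
by apply: (DeriveDef dF); rewrite -derive1E.
Qed.

(** With a finite sum in place of the time integral, averaging over the torus needs only linearity
    of the integral. On each step the mean value theorem is applied to a primitive F, then to h
    itself. *)
Lemma Rintegral_I01_le_sum (h dh : R -> R) (M : R) (N : nat) : (0 < N)%N ->
  (forall t : R, is_derive t 1 h (dh t)) -> (forall t, `|dh t| <= M) ->
  \int[mu]_(t in I01) h t <= \sum_(k < N) N%:R^-1 * h (k%:R / N%:R) + M / N%:R.
Proof.
move=> N0 dhP dhM; set d : R := N%:R^-1.
have NR0 : (0 : R) < N%:R by rewrite ltr0n.
have d0 : 0 < d by rewrite invr_gt0.
have ch : continuous h.
  by move=> t; apply/differentiable_continuous/derivable1_diffP; case: (dhP t).
have [F dF] := exists_primitive_I01 ch.
rewrite (Rintegral_I01_derive ch dF).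
have Nd : N%:R * d = 1 by rewrite divff// gt_eqF.
have step n : (n < N)%N -> F (n.+1%:R * d) - F (n%:R * d) <= d * h (n%:R * d) + d * (d * M).
  move=> nN.
  have a0 : 0 <= n%:R * d by rewrite mulr_ge0 ?ler0n// ltW.
  have b1 : n.+1%:R * d <= 1 by rewrite -[leRHS]Nd ler_wpM2r ?ler_nat ?(ltW d0).
  have ab : n.+1%:R * d = n%:R * d + d by rewrite -natr1 mulrDl mul1r.
  have inI t : n%:R * d <= t <= n.+1%:R * d -> 0 <= t <= 1 by lra.
  have le_ab : n%:R * d <= n.+1%:R * d by lra.
  have dFab t : t \in `](n%:R * d), (n.+1%:R * d)[ -> is_derive t 1 F (h t).
    by rewrite in_itv/= => /andP[a1 a2]; apply: dF; apply: inI; rewrite !ltW.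
  have cF : {within `[(n%:R * d), (n.+1%:R * d)], continuous F}.
    by apply: derivable_within_continuous => t; rewrite in_itv/= => /inI/dF[].
  have [c] := MVT_segment le_ab dFab cF.
  rewrite in_itv/= => /andP[ac cb] ->.
  have -> : n.+1%:R * d - n%:R * d = d by rewrite ab addrC addKr.
  rewrite mulrC -mulrDr ler_wpM2l ?(ltW d0)//.
  have [e _ he] := MVT_segment ac (fun t _ => dhP t) (continuous_subspaceT ch).
  rewrite -lerBlDl he mulrC; apply: le_trans (ler_norm _) _.
  by rewrite normrM ler_pM// ger0_norm; lra.
have sum n : (n <= N)%N ->
    F (n%:R * d) - F 0 <= \sum_(k < n) d * h (k%:R * d) + n%:R * (d * (d * M)).
  elim: n => [|n IHn] nN; first by rewrite mul0r subrr big_ord0 mul0r addr0.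
  have := IHn (ltnW nN); have := step n nN; rewrite big_ord_recr/=.
  have -> : n.+1%:R * (d * (d * M)) = n%:R * (d * (d * M)) + d * (d * M).
    by rewrite -natr1 mulrDl mul1r.
  lra.
have := sum N (leqnn N); rewrite Nd => /le_trans; apply.
by rewrite mulrA Nd mul1r [M / _]mulrC.
Qed.
End RiemannSum.

(** * Averaging over the translation flow *)

Section Averaging.
Context {R : realType}.

Lemma derive_lincomb (V : normedModType R) (k1 k2 : R) (f1 f2 : V -> R) v p :
  differentiable f1 p -> differentiable f2 p ->
  'D_v (fun q => k1 * f1 q + k2 * f2 q) p = k1 * 'D_v f1 p + k2 * 'D_v f2 p.
Proof.
move=> d1 d2; have D1 : derivable f1 p v by exact: diff_derivable.
have D2 : derivable f2 p v by exact: diff_derivable.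
rewrite -[LHS]/('D_v ((k1 \*: f1) + (k2 \*: f2)) p).
rewrite deriveD; [|exact: derivableZ..].
by rewrite !deriveZ.
Qed.

Lemma pair_add1 (u v : R * R) : (u + v).1 = u.1 + v.1. Proof. by []. Qed.
Lemma pair_add2 (u v : R * R) : (u + v).2 = u.2 + v.2. Proof. by []. Qed.

Notation mu := (@lebesgue_measure R).
Notation mu2 := ((mu \x mu)%E).
Notation I01 := (`[0%R, 1%R]%classic : set R).
Notation Q := (I01 `*` I01).
Variables (phi : R * R -> R * R) (A B : R * R).
Hypotheses (Cphi : Ck 2 phi) (phi1 : forall p, phi (p + (1, 0)) = phi p + A)
  (phi2 : forall p, phi (p + (0, 1)) = phi p + B).

Definition jac_map (f : R * R -> R * R) p :=
  jacobian2 (fun p => (f p).1) (fun p => (f p).2) p.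

Lemma jac_map_continuous : continuous (jac_map phi).
Proof.
have [_ d1] := Ck_fst Cphi; have [_ d2] := Ck_snd Cphi.
have c1 v : continuous (fun p => 'D_v (fun p => (phi p).1) p) := CkS (n := 0) (d1 v).
have c2 v : continuous (fun p => 'D_v (fun p => (phi p).2) p) := CkS (n := 0) (d2 v).
move=> p; rewrite /jac_map /jacobian2; apply: cvgB; apply: cvgM.
- exact: c1.
- exact: c2.
- exact: c1.
- exact: c2.
Qed.

Lemma Rintegral_jac_map : \int[mu2]_(p in Q) jac_map phi p = det2 A B.
Proof.
rewrite [LHS](@Rintegral_jacobian2 _ _ _ A.1 B.1 A.2 B.2).
- by rewrite /det2 mulrC [B.1 * _]mulrC mulrC.
- exact/CkS/Ck_fst.
- exact: Ck_snd.
- by move=> p; rewrite phi1.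
- by move=> p; rewrite phi2.
- by move=> p; rewrite phi1.
- by move=> p; rewrite phi2.
Qed.

Variable g : R * R -> R.
Hypotheses (Cg : Ck 2 g) (gA : forall y, g (y + A) = g y) (gB : forall y, g (y + B) = g y).

(* The integrand is the Jacobian of the periodic function g (phi p + s) and of
   w.1 * phi.2 - w.2 * phi.1, i.e. a null Lagrangian. *)
Lemma Rintegral_derive_jac_map (w s : R * R) :
  \int[mu2]_(p in Q) ('D_w g (phi p + s) * jac_map phi p) = 0.
Proof.
pose a p := g (phi p + s).
pose b p := w.1 * (phi p).2 + (- w.2) * (phi p).1.
have Cs : Ck 2 (fun p => phi p + s) by exact: (CkD Cphi (Ck_cst _ _ _)).
have Ca : Ck 2 a := Ck_comp Cg Cs.
have Cb : Ck 2 b.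
  exact: (CkD (CkM (Ck_cst _ _ _) (Ck_snd Cphi)) (CkM (Ck_cst _ _ _) (Ck_fst Cphi))).
have dphi p : differentiable phi p := Cphi.1 p.
have [df1 _] := Ck_fst Cphi; have [df2 _] := Ck_snd Cphi.
have Db v p : 'D_v b p = w.1 * ('D_v phi p).2 - w.2 * ('D_v phi p).1.
  rewrite (derive_lincomb _ _ _ (df2 p) (df1 p)) (derive_fst _ (dphi p)) (derive_snd _ (dphi p)).
  by rewrite mulNr.
have Da v p : 'D_v a p = ('D_v phi p).1 * 'D_(1, 0) g (phi p + s)
                       + ('D_v phi p).2 * 'D_(0, 1) g (phi p + s).
  have dg q : differentiable g q := Cg.1 q.
  rewrite -[LHS]/('D_v (g \o (fun p => phi p + s)) p) (derive_comp v (Cs.1 p) (dg _)).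
  rewrite (deriveD (diff_derivable (dphi p)) (derivable_cst s p v)) derive_cst addr0.
  exact: derive_coord.
have -> : \int[mu2]_(p in Q) ('D_w g (phi p + s) * jac_map phi p) =
          \int[mu2]_(p in Q) jacobian2 a b p.
  apply: eq_Rintegral => p _.
  rewrite /jacobian2 !Da !Db (derive_coord _ (Cg.1 _)) /jac_map /jacobian2.
  rewrite !derive_fst// !derive_snd//.
  move: ('D_(1, 0) g _) ('D_(0, 1) g _) ('D_(1, 0) phi p) ('D_(0, 1) phi p) => g1 g2 u v.
  ring.
rewrite (@Rintegral_jacobian2 _ a b 0 0 (w.1 * A.2 - w.2 * A.1) (w.1 * B.2 - w.2 * B.1)).
- by rewrite !mul0r subrr.
- exact: CkS.
- exact: Cb.
- by move=> p; rewrite /a phi1 addrAC gA addr0.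
- by move=> p; rewrite /a phi2 addrAC gB addr0.
- by move=> p; rewrite /b phi1 pair_add1 pair_add2; ring.
- by move=> p; rewrite /b phi2 pair_add1 pair_add2; ring.
Qed.

Hypothesis phi_surj : forall y, exists p, phi p = y.

(** Composition with phi turns the periods A and B into the standard ones, for which the unit square
    is a compact fundamental domain; surjectivity of phi brings the bound back. *)
Lemma derive_bounded w : exists M, forall y, `|'D_w g y| <= M.
Proof.
have [dg _] := Cg; have cg := (Cg.2 w : Ck 1 _).
have [|||M hM] := @periodic_bounded _ (fun p => 'D_w g (phi p)).
- move=> p; apply: (@continuous_comp _ _ _ phi (fun y => 'D_w g y)).
    exact: (CkS (CkS Cphi)).
  exact: (CkS cg).
- by move=> p; rewrite phi1 (@derive_shift_invariant _ g w _ _ 0 dg)// => q; rewrite gA addr0.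
- by move=> p; rewrite phi2 (@derive_shift_invariant _ g w _ _ 0 dg)// => q; rewrite gB addr0.
by exists M => y; have [p <-] := phi_surj y.
Qed.

Lemma derive2_bounded w : exists M, forall y, `|'D_w (fun y => 'D_w g y) y| <= M.
Proof.
have [dg _] := Cg; have [ddg cdg] := (Cg.2 w : Ck 1 _).
have DA q : 'D_w g (q + A) = 'D_w g q + 0.
  by rewrite (@derive_shift_invariant _ g w _ _ 0 dg) ?addr0// => y; rewrite gA addr0.
have DB q : 'D_w g (q + B) = 'D_w g q + 0.
  by rewrite (@derive_shift_invariant _ g w _ _ 0 dg) ?addr0// => y; rewrite gB addr0.
have [|||M hM] := @periodic_bounded _ (fun p => 'D_w (fun y => 'D_w g y) (phi p)).
- move=> p; apply: (@continuous_comp _ _ _ phi (fun y => 'D_w (fun y => 'D_w g y) y)).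
    exact: (CkS (CkS Cphi)).
  exact: cdg.
- by move=> p; rewrite phi1 (derive_shift_invariant _ _ ddg DA).
- by move=> p; rewrite phi2 (derive_shift_invariant _ _ ddg DB).
by exists M => y; have [p <-] := phi_surj y.
Qed.

Lemma taylor2_le w : exists M, forall y (s : R), 0 < s ->
  g (y + s *: w) <= g y + s * 'D_w g y + s ^+ 2 * M.
Proof.
have [M hM] := derive2_bounded w; exists M => y s s0.
have [dg _] := Cg; have [ddg _] := (Cg.2 w : Ck 1 _).
have [c /andP[c0 cs] hc] := MVT_line y w s0 dg.
rewrite -lerBlDl opprD addrA hc -mulrBr expr2 -mulrA ler_wpM2l ?(ltW s0)//.
(* The mean value theorem for the first derivative needs a segment of positive length, so c = 0 is
   treated apart. *)
have [->|cn0] := eqVneq c 0.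
  rewrite scale0r addr0 subrr mulr_ge0 ?(ltW s0)//; exact: le_trans (hM y).
have cgt0 : 0 < c by rewrite lt0r cn0.
have [d _ ->] := MVT_line y w cgt0 ddg.
apply: le_trans (ler_norm _) _; rewrite normrM ler_pM//.
by rewrite ger0_norm.
Qed.

(** The mean of the orbit averages is at most the mean of g. Each orbit average is compared with a
    Riemann sum over N sample times, the sum is integrated term by term, and N is then taken
    large. *)
Lemma average_le (w : R * R) (e l : R) :
  (forall p, `|jac_map phi p| = e * jac_map phi p) ->
  \int[mu2]_(p in Q) `|jac_map phi p| = 1 ->
  (forall p, l <= \int[mu]_(t in I01) g (phi p + t *: w)) ->
  l <= \int[mu2]_(p in Q) (g (phi p) * `|jac_map phi p|).
Proof.
move=> eJ J1 hl; set rho := fun p => `|jac_map phi p|.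
have crho : continuous rho by move=> p; apply: cvg_norm; exact: jac_map_continuous.
have rho0 p : 0 <= rho p by exact: normr_ge0.
have [M1 hM1] := derive_bounded w; have [M2 hM2] := taylor2_le w.
(* A common constant: the first derivative controls the Riemann sum, the second the Taylor
   remainder. *)
pose M := Num.max M1 M2.
have {}hM1 y : `|'D_w g y| <= M by rewrite (le_trans (hM1 y))// le_max lexx.
have {}hM2 y (s : R) : 0 < s -> g (y + s *: w) <= g y + s * 'D_w g y + s ^+ 2 * M.
  move=> s0; apply: le_trans (hM2 y s s0) _.
  by rewrite lerD2l ler_wpM2l ?sqr_ge0// le_max lexx orbT.
have M0 : 0 <= M := le_trans (normr_ge0 _) (hM1 0).
have cphi : continuous phi := CkS (CkS Cphi).
have cg : continuous g := CkS (CkS Cg).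
have cDg : continuous (fun y => 'D_w g y) := CkS (n := 0) (Cg.2 w).
have cshift (h : R * R -> R) s : continuous h -> continuous (fun p => h (phi p + s)).
  move=> ch p; apply: (@continuous_comp _ _ _ (fun p => phi p + s) h); last exact: ch.
  by apply: cvgD; [exact: cphi|exact: cvg_cst].
have crhoM (h : R * R -> R) : continuous h -> continuous (fun p => h p * rho p).
  by move=> ch p; apply: cvgM; [exact: ch|exact: crho].
have cZ k (h : R * R -> R) : continuous h -> continuous (fun p => k * h p).
  by move=> ch p; apply: cvgM; [exact: cvg_cst|exact: ch].
have cD (h1 h2 : R * R -> R) : continuous h1 -> continuous h2 ->
    continuous (fun p => h1 p + h2 p).
  by move=> c1 c2 p; apply: cvgD; [exact: c1|exact: c2].
pose Phi (s : R) := \int[mu2]_(p in Q) (g (phi p + s *: w) * rho p).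
(* The term of order d integrates to zero, so N steps of length 1 / N change
   the mean by O(1 / N) only. *)
have drift s d : 0 < d -> Phi (s + d) <= Phi s + d ^+ 2 * M.
  move=> d0.
  have D0 : \int[mu2]_(p in Q) ('D_w g (phi p + s *: w) * rho p) = 0.
    have -> : \int[mu2]_(p in Q) ('D_w g (phi p + s *: w) * rho p)
            = \int[mu2]_(p in Q) (e * ('D_w g (phi p + s *: w) * jac_map phi p)).
      by apply: eq_Rintegral => p _; rewrite /rho eJ mulrCA.
    rewrite Rintegral_squareZ ?Rintegral_derive_jac_map ?mulr0// => p.
    by apply: cvgM; [exact: (cshift _ _ cDg)|exact: jac_map_continuous].
  pose u p := g (phi p + s *: w) * rho p.
  pose v p := d * ('D_w g (phi p + s *: w) * rho p).
  pose z p := (d ^+ 2 * M) * rho p.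
  have cu : continuous u := crhoM _ (cshift _ (s *: w) cg).
  have cv : continuous v := cZ d _ (crhoM _ (cshift _ (s *: w) cDg)).
  have cz : continuous z := cZ (d ^+ 2 * M) _ crho.
  apply: (@le_trans _ _ (\int[mu2]_(p in Q) ((u p + v p) + z p))).
    apply: le_Rintegral_square.
    - exact: (crhoM _ (cshift _ ((s + d) *: w) cg)).
    - exact: (cD _ _ (cD _ _ cu cv) cz).
    move=> p; rewrite /u /v /z mulrA -mulrDl -mulrDl ler_wpM2r//.
    by rewrite scalerDl addrA; exact: hM2.
  rewrite (Rintegral_squareD (cD _ _ cu cv) cz) (Rintegral_squareD cu cv).
  rewrite (Rintegral_squareZ _ (crhoM _ (cshift _ _ cDg))) D0 mulr0 addr0.
  by rewrite (Rintegral_squareZ _ crho) J1 mulr1.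
have Phi_le (d : R) n : 0 < d -> Phi (n%:R * d) <= Phi 0 + n%:R * (d ^+ 2 * M).
  move=> d0; elim: n => [|n IHn]; first by rewrite !mul0r addr0.
  rewrite -natr1 !mulrDl !mul1r addrA; apply: le_trans (drift _ _ d0) _; by rewrite lerD2r.
(* One M / N bounds the drift accumulated over at most N steps, the other the error of the Riemann
   sum. *)
have key N : (0 < N)%N -> l <= Phi 0 + 2 * M / N%:R.
  move=> N0; set d : R := N%:R^-1.
  have NR0 : (0 : R) < N%:R by rewrite ltr0n.
  have d0 : 0 < d by rewrite invr_gt0.
  have Nd : N%:R * d = 1 by rewrite divff// gt_eqF.
  pose S n p := \sum_(k < n) d * g (phi p + (k%:R * d) *: w).
  have cS n : continuous (S n).
    elim: n => [|n IHn]; rewrite /S.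
      rewrite (_ : (fun p => _) = cst 0); first exact: cst_continuous.
      by apply/funext => p; rewrite big_ord0.
    rewrite (_ : (fun p => _) = fun p => S n p + d * g (phi p + (n%:R * d) *: w)).
      move=> p; apply: cvgD; first exact: IHn.
      exact: (cZ d _ (cshift _ _ cg) p).
    by apply/funext => p; rewrite big_ord_recr.
  have IS n : (n <= N)%N ->
      \int[mu2]_(p in Q) (S n p * rho p) <= (n%:R * d) * (Phi 0 + M * d).
    elim: n => [|n IHn] nN.
      rewrite (_ : (fun p => _) = fun p => 0 * rho p).
        by rewrite Rintegral_squareZ// !mul0r.
      by apply/funext => p; rewrite /S big_ord0.
    have -> : \int[mu2]_(p in Q) (S n.+1 p * rho p) =
        \int[mu2]_(p in Q) (S n p * rho p + d * (g (phi p + (n%:R * d) *: w) * rho p)).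
      by apply: eq_Rintegral => p _; rewrite /S big_ord_recr/= mulrDl -mulrA.
    have cgn : continuous (fun p => g (phi p + (n%:R * d) *: w) * rho p).
      exact: (crhoM _ (cshift _ _ cg)).
    rewrite (Rintegral_squareD (crhoM _ (cS n)) (cZ d _ cgn)).
    rewrite (Rintegral_squareZ _ cgn) -natr1 !mulrDl mul1r lerD ?IHn ?(ltnW nN)//.
    rewrite ler_wpM2l ?(ltW d0)//; apply: le_trans (Phi_le d n d0) _.
    rewrite lerD2l expr2 -mulrA mulrA [M * d]mulrC ler_piMl//.
      by rewrite mulr_ge0// ltW.
    by rewrite -[leRHS]Nd ler_wpM2r ?(ltW d0)// ler_nat ltnW.
  have le1 p : l <= S N p + M * d.
    apply: le_trans (hl p) _; rewrite mulrC.
    have Dg (t : R) := is_derive_line (Cg.1 (phi p + t *: w)).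
    have := @Rintegral_I01_le_sum _ _ _ M N N0 Dg (fun t => hM1 _).
    by rewrite [M / _]mulrC.
  have : \int[mu2]_(p in Q) (l * rho p) <= \int[mu2]_(p in Q) (S N p * rho p + (M * d) * rho p).
    apply: le_Rintegral_square.
    - exact: (cZ l _ crho).
    - exact: (cD _ _ (crhoM _ (cS N)) (cZ _ _ crho)).
    - by move=> p; rewrite -mulrDl ler_wpM2r.
  rewrite (Rintegral_squareD (crhoM _ (cS N)) (cZ _ _ crho)).
  rewrite !(Rintegral_squareZ _ crho) J1 !mulr1.
  have := IS N (leqnn N); rewrite Nd mul1r; lra.
have -> : \int[mu2]_(p in Q) (g (phi p) * rho p) = Phi 0.
  by apply: eq_Rintegral => p _; rewrite scale0r addr0.
apply/ler_addgt0Pr => x x0.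
pose N := (Num.truncn (2 * M / x)).+1.
apply: le_trans (key N isT) _; rewrite lerD2l ler_pdivrMr ?ltr0n//.
by rewrite [x * _]mulrC -ler_pdivrMr// ltW// truncnS_gt.
Qed.

End Averaging.

(** * The systole of a conformally flat torus *)

Section FlatTorus.
Context {R : realType}.
Notation mu := (@lebesgue_measure R).
Notation mu2 := ((mu \x mu)%E).
Notation I01 := (`[0%R, 1%R]%classic : set R).
Notation Q := (I01 `*` I01).
Implicit Types (G : torus_metric R) (p u v z : R * R).

(** Gram-Schmidt: x = e2 - (F / E) e1 is orthogonal to e1, and E times the squared norm of x is the
    Gram determinant. *)
Lemma gram_pos G p : 0 < G p (1, 0) (1, 0) * G p (0, 1) (0, 1) - G p (1, 0) (0, 1) ^+ 2.
Proof.
have E0 : 0 < G p (1, 0) (1, 0).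
  by apply: metric_pos; apply/eqP => -[/eqP]; rewrite oner_eq0.
have [c cE] : exists c, c * G p (1, 0) (1, 0) = - G p (1, 0) (0, 1).
  by exists (- G p (1, 0) (0, 1) / G p (1, 0) (1, 0)); rewrite divfK// gt_eqF.
pose x : R * R := c *: (1, 0) + (0, 1).
have x0 : x != 0.
  apply/eqP => /(congr1 snd); rewrite /x pair_add2 -[(c *: (1, 0)).2]/(c * 0) mulr0 add0r /=.
  by move/eqP; rewrite oner_eq0.
have := metric_pos G p x0; rewrite {1}/x metric_linear.
rewrite ![G p _ x]metric_sym /x !metric_linear [G p (0, 1) (1, 0)]metric_sym.
rewrite cE addNr mulr0 add0r => h; have := mulr_gt0 E0 h.
by rewrite mulrDr mulrA [_ * c]mulrC cE mulNr -expr2 addrC.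
Qed.

Lemma area_density_gt0 G p : 0 < area_density G p.
Proof. by rewrite sqrtr_gt0 gram_pos. Qed.

Lemma area_density_pullback G (phi : R * R -> R * R) p : differentiable phi p ->
  (forall u v, G p u v = dot ('D_u phi p) ('D_v phi p)) ->
  area_density G p = `|jac_map phi p|.
Proof.
move=> dphi hG; rewrite /area_density !hG lagrange_id addrAC subrr add0r sqrtr_sqr; congr `|_|.
rewrite /det2 /jac_map /jacobian2 !(derive_fst _ dphi) !(derive_snd _ dphi).
by congr (_ - _); exact: mulrC.
Qed.

Lemma area_density_conformal G G0 f p : conformal_factor G G0 f ->
  area_density G p = f p ^+ 2 * area_density G0 p.
Proof.
move=> [_ _ f0 hG]; rewrite /area_density !hG.
rewrite (_ : _ - _ = (f p ^+ 2) ^+ 2 *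
  (G0 p (1, 0) (1, 0) * G0 p (0, 1) (0, 1) - G0 p (1, 0) (0, 1) ^+ 2)); last by ring.
by rewrite sqrtrM ?sqr_ge0// sqrtr_sqr ger0_norm// sqr_ge0.
Qed.

(** In dimension two the area element scales by f^2, so [area G] is the second moment of f; unit
    area makes the measure a probability. *)
Lemma conformal_variance G G0 f : continuous (area_density G0) -> area G0 = 1 ->
  conformal_factor G G0 f -> torus_variance G0 f = area G - torus_mean G0 f ^+ 2.
Proof.
move=> crho area1 hf; have [Sf _ _ _] := hf.
have cf : continuous f := Sf 0%N.
set m := torus_mean G0 f.
have cM (h1 h2 : R * R -> R) : continuous h1 -> continuous h2 ->
    continuous (fun p => h1 p * h2 p).
  by move=> c1 c2 p; apply: cvgM; [exact: c1|exact: c2].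
have cD (h1 h2 : R * R -> R) : continuous h1 -> continuous h2 ->
    continuous (fun p => h1 p + h2 p).
  by move=> c1 c2 p; apply: cvgD; [exact: c1|exact: c2].
have cC (k : R) : continuous (fun _ : R * R => k) by exact: cst_continuous.
have c0 := crho; have c1 := cM _ _ cf crho; have c2 := cM _ _ cf c1.
have -> : area G = \int[mu2]_(p in Q) (f p * (f p * area_density G0 p)).
  by apply: eq_Rintegral => p _; rewrite mul1r (area_density_conformal _ hf) expr2 mulrA.
have -> : torus_variance G0 f = \int[mu2]_(p in Q) (f p * (f p * area_density G0 p) +
    (((- (2 * m)) * (f p * area_density G0 p)) + m ^+ 2 * area_density G0 p)).
  apply: eq_Rintegral => p _; rewrite -/m.
  by move: (f p) (area_density G0 p) => x y; ring.
rewrite (Rintegral_squareD c2 (cD _ _ (cM _ _ (cC (- (2 * m))) c1) (cM _ _ (cC (m ^+ 2)) c0))).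
rewrite (Rintegral_squareD (cM _ _ (cC (- (2 * m))) c1) (cM _ _ (cC (m ^+ 2)) c0)).
rewrite (Rintegral_squareZ _ c1) (Rintegral_squareZ _ c0).
have -> : \int[mu2]_(p in Q) (f p * area_density G0 p) = m by [].
have -> : \int[mu2]_(p in Q) area_density G0 p = 1.
  by rewrite -[RHS]area1; apply: eq_Rintegral => p _; rewrite mul1r.
by rewrite expr2; ring.
Qed.

Lemma loop_length_ge0 G (c : R -> R * R) : 0 <= loop_length G c.
Proof. by apply: Rintegral_ge0 => t _; exact: sqrtr_ge0. Qed.

Lemma systole_le G (c : R -> R * R) : torus_loop c -> ~ contractible_loop c ->
  systole G <= loop_length G c.
Proof.
move=> lc nc; apply: ge_inf; last by exists c.
(* A real [inf] lies below the elements of its set only if the set has a lower bound; here 0 is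
   one. *)
by exists 0 => _ [d [_ _ ->]]; exact: loop_length_ge0.
Qed.

Lemma systole_ge0 G (c : R -> R * R) : torus_loop c -> ~ contractible_loop c ->
  0 <= systole G.
Proof.
move=> lc nc; apply: lb_le_inf; first by exists (loop_length G c), c.
by move=> _ [d [_ _ ->]]; exact: loop_length_ge0.
Qed.

(** * Closed geodesics of the flat metric *)

Section Geodesic.
Variables (G G0 : torus_metric R) (f : R * R -> R) (phi psi : R * R -> R * R) (A B : R * R).
Hypotheses (hf : conformal_factor G G0 f) (Sphi : smooth phi) (Spsi : smooth psi)
  (phiK : cancel phi psi) (psiK : cancel psi phi)
  (hG0 : forall p u v, G0 p u v = dot ('D_u phi p) ('D_v phi p))
  (phiA : forall p, phi (p + (1, 0)) = phi p + A)
  (phiB : forall p, phi (p + (0, 1)) = phi p + B).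

Lemma phi_lattice_point (m n : int) p :
  phi (p + (m%:~R, n%:~R)) = phi p + lattice_point A B m n.
Proof.
rewrite -std_lattice_point !scaler_int addrA (shift_int phiB) (shift_int phiA).
by rewrite /lattice_point !scaler_int addrA.
Qed.

Definition geodesic (m n : int) p (t : R) : R * R := psi (phi p + t *: lattice_point A B m n).

Lemma geodesic_C1 m n p : Ck 1 (geodesic m n p).
Proof. exact: (Ck_comp2 (Spsi 1) (Ck_line _ _ _)). Qed.

Lemma geodesic_end m n p : geodesic m n p 1 = geodesic m n p 0 + (m%:~R, n%:~R).
Proof. by rewrite /geodesic scale1r scale0r addr0 -phi_lattice_point !phiK. Qed.

Lemma geodesic_loop m n p : torus_loop (geodesic m n p).
Proof.
split; last by apply/Z2P; exists m, n; rewrite geodesic_end addrC addKr.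
exists [:: 1]; split; rewrite //= ?ltr01//.
by move=> i _; exists (geodesic m n p); split; [exact: geodesic_C1|].
Qed.

Lemma geodesic_noncontractible m n p : (m != 0) || (n != 0) ->
  ~ contractible_loop (geodesic m n p).
Proof.
move=> mn /contractible_loop_closed; rewrite geodesic_end => /eqP.
rewrite -subr_eq0 addrC addKr => /eqP[/eqP + /eqP]; rewrite !intr_eq0 => m0 n0.
by move: mn; rewrite m0 n0.
Qed.

(** The map phi straightens the curve: its image has constant velocity w, so the speed is |w| for G0
    and f |w| for G. *)
Lemma geodesic_length m n p : let w := lattice_point A B m n in
  loop_length G (geodesic m n p) =
  Num.sqrt (dot w w) * \int[mu]_(t in I01) f (psi (phi p + t *: w)).
Proof.
move=> w; have [Sf _ f0 hG] := hf.
have cc : continuous (geodesic m n p) := CkS (geodesic_C1 m n p).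
have cfc : continuous (fun t : R => f (psi (phi p + t *: w))).
  by move=> t; apply: (@continuous_comp _ _ _ (geodesic m n p) f); [exact: cc|exact: (Sf 0%N)].
rewrite -RintegralZl//; last exact: continuous_integrable_I01.
apply: eq_Rintegral => t _.
have dc := (geodesic_C1 m n p).1 t; have dphi := (Sphi 1).1 (geodesic m n p t).
have vel : 'D_('D_1 (geodesic m n p) t) phi (geodesic m n p t) = w.
  rewrite -derive_comp// (_ : phi \o _ = fun s : R => phi p + s *: w).
    by rewrite derive_line scale1r.
  by apply/funext => s; exact: psiK.
by rewrite hG hG0 vel sqrtrM ?sqr_ge0// sqrtr_sqr ger0_norm ?(ltW (f0 _))// mulrC.
Qed.
End Geodesic.

End FlatTorus.

Theorem mainTheorem1 (R : realType) (G G0 : torus_metric R) (f : R * R -> R)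
    (hflat : flat G0) (harea : area G0 = 1) (hf : conformal_factor G G0 f) :
  area G - Num.sqrt 3 / 2 * systole G ^+ 2 >= torus_variance G0 f.
Proof.
have [a [b [phi [psi [ab [Sphi Spsi] [phiK psiK] hlat hG0]]]]] := hflat.
have [Sf fper f0 hG] := hf.
have Z1 : Z2 ((1, 0) : R * R) by apply/Z2P; exists 1, 0.
have Z01 : Z2 ((0, 1) : R * R) by apply/Z2P; exists 0, 1.
have [A phiA] := flat_deck ab (Sphi 0%N) hlat Z1.
have [B phiB] := flat_deck ab (Sphi 0%N) hlat Z01.
have dphi p : differentiable phi p := (Sphi 1).1 p.
have rhoE p : area_density G0 p = `|jac_map phi p| := area_density_pullback (dphi p) (hG0 p).
have cJ : continuous (jac_map phi) := jac_map_continuous (Sphi 2).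
have J0 p : jac_map phi p != 0 by rewrite -normr_gt0 -rhoE area_density_gt0.
have [e e1 eJ] := constant_sign cJ J0.
have crho : continuous (area_density G0).
  by rewrite (funext rhoE) => p; apply: cvg_norm; exact: cJ.
have J1 : Rintegral (lebesgue_measure \x lebesgue_measure)%E (`[0, 1] `*` `[0, 1])
    (fun p => `|jac_map phi p|) = 1.
  by rewrite -[RHS]harea; apply: eq_Rintegral => p _; rewrite mul1r rhoE.
have det1 : `|det2 A B| = 1.
  have : e * det2 A B = 1.
    rewrite -J1 -(Rintegral_jac_map (Sphi 2) phiA phiB) -(Rintegral_squareZ _ cJ).
    by apply: eq_Rintegral => p _; rewrite eJ.
  by move=> /(congr1 Num.norm); rewrite normrM e1 mul1r normr1.
have [m [n [mn short]]] := hermite_constant2 det1.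
set w := lattice_point A B m n in short.
pose c := geodesic phi psi A B m n.
have cloop p : torus_loop (c p) := geodesic_loop Spsi phiK phiA phiB m n p.
have cnc p : ~ contractible_loop (c p) := geodesic_noncontractible phiK phiA phiB mn.
have sys0 : 0 <= systole G := systole_ge0 G (cloop 0) (cnc 0).
pose s := Num.sqrt (dot w w).
have s0 : 0 < s.
  by rewrite sqrtr_gt0 dot_lattice_point_gt0// -normr_gt0 det1.
(* The conformal factor in flat coordinates. Since y + A = phi (psi y + (1, 0)), and likewise for B,
   the periodicity of f gives g the periods A and B. *)
pose g y := f (psi y).
have gper z y : Z2 z -> g (phi (psi y + z)) = g y.
  by move=> Zz; rewrite /g phiK fper.
have gA y : g (y + A) = g y by rewrite -[in LHS](psiK y) -phiA gper.
have gB y : g (y + B) = g y by rewrite -[in LHS](psiK y) -phiB gper.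
have Cg : Ck 2 g := Ck_comp (Sf 2) (Spsi 2).
have surj y : exists p, phi p = y by exists (psi y); exact: psiK.
(* Division by s = |w| gives a lower bound, uniform in p, for the averages of g along the flow
   lines. *)
have len p : systole G / s <= \int[lebesgue_measure]_(t in `[0, 1]) g (phi p + t *: w).
  rewrite ler_pdivrMr// mulrC.
  have := systole_le G (cloop p) (cnc p).
  by rewrite (geodesic_length A B hf Sphi Spsi psiK hG0 m n p).
have := average_le (Sphi 2) phiA phiB Cg gA gB surj eJ J1 len.
have -> : Rintegral (lebesgue_measure \x lebesgue_measure)%E (`[0, 1] `*` `[0, 1])
    (fun p => g (phi p) * `|jac_map phi p|) = torus_mean G0 f.
  by apply: eq_Rintegral => p _; rewrite rhoE /g phiK.
rewrite ler_pdivrMr// (conformal_variance crho harea hf) lerD2l lerN2.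
set M := torus_mean G0 f => sysM.
have s2 : s ^+ 2 = dot w w by rewrite sqr_sqrtr// dot_ge0.
(* Squared, this reads 3 / 4 * |w|^4 <= 1, which is the bound 4 / 3 of Hermite's inequality. *)
have short' : Num.sqrt 3 / 2 * dot w w <= 1.
  rewrite -(@ler_pXn2r _ 2)// ?nnegrE ?mulr_ge0 ?dot_ge0 ?sqrtr_ge0//.
  rewrite expr1n !exprMn sqr_sqrtr//; lra.
apply: (@le_trans _ _ (Num.sqrt 3 / 2 * (M * s) ^+ 2)).
  rewrite ler_wpM2l ?divr_ge0 ?sqrtr_ge0//.
  by rewrite ler_pXn2r// nnegrE// (le_trans sys0).
rewrite exprMn s2 [M ^+ 2 * _]mulrC mulrA ler_piMl ?sqr_ge0//.
Qed.
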